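(* Let $\Gamma$ be the $\mathbb{Z}$-periodic graph with one-element fundamental cell defined by the Floquet function $h(\theta)=(\theta-\frac12)^2$, $\theta\in[0,1]$. Then $$\|e^{it\mathcal{H}_\Gamma}\|_{\ell^1(\mathbb{Z})\to\ell^\infty(\mathbb{Z})}\le 8\,t^{-1/2}$$ for all $t>0$. The exponent $-\frac12$ is sharp, i.e. there are no $\beta>\frac12$ and $C>0$ such that $\|e^{it\mathcal{H}_\Gamma}\|_{\ell^1\to\ell^\infty}\le Ct^{-\beta}$ for all $t\ge 1$.
   Context: The graph defined by a function $h$ on $\mathbb{T}=\mathbb{R}/\mathbb{Z}$ with non-negative, symmetric, summable Fourier coefficients $\widehat h(k)=\int_0^1h(\theta)e^{-2\pi ik\theta}\,d\theta$ has vertex set $\mathbb{Z}$, edge weight $w(k)=\widehat h(k)$ between $n$ and $n+k$ ($k\ne0$) and constant potential $Q=\widehat h(0)$; its Schrödinger operator is $(\mathcal{H}_\Gamma\psi)(n)=\sum_{k\neq0}\widehat h(k)\psi(n+k)+\widehat h(0)\psi(n)$ on $\ell^2(\mathbb{Z})$. $\|B\|_{\ell^1\to\ell^\infty}=\sup_{\|\psi\|_1\le1}\|B\psi\|_\infty$. *)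

(* Defs.v *)
From Stdlib Require Import Reals ZArith Lra Lia ClassicalEpsilon.
From Coquelicot Require Import Coquelicot.

Set Implicit Arguments.
Unset Strict Implicit.

Local Open Scope R_scope.

(* Sums over Z are the sum of two one-sided series; they are only ever used
   for absolutely summable families, where the order is immaterial. *)
Definition summableZ (f : Z -> R) : Prop :=
  ex_series (fun j : nat => Rabs (f (Z.of_nat j))) /\
  ex_series (fun j : nat => Rabs (f (- Z.of_nat (S j))%Z)).

Definition sumZ (f : Z -> R) : R :=
  Series (fun j : nat => f (Z.of_nat j)) +
  Series (fun j : nat => f (- Z.of_nat (S j))%Z).

Definition CsumZ (f : Z -> C) : C :=
  (sumZ (fun k => Re (f k)), sumZ (fun k => Im (f k))).

Definition in_l1 (psi : Z -> C) : Prop := summableZ (fun n => Cmod (psi n)).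

Definition norm1 (psi : Z -> C) : R := sumZ (fun n => Cmod (psi n)).

Definition in_l2 (psi : Z -> C) : Prop := summableZ (fun n => Cmod (psi n) ^ 2).

Definition norm2 (psi : Z -> C) : R := sqrt (sumZ (fun n => Cmod (psi n) ^ 2)).

Definition norm_infty (psi : Z -> C) : Rbar :=
  Lub_Rbar (fun x => exists n : Z, x = Cmod (psi n)).

Definition norm_l1_linfty (B : (Z -> C) -> (Z -> C)) : Rbar :=
  Rbar_lub (fun x => exists psi : Z -> C,
    in_l1 psi /\ norm1 psi <= 1 /\ x = norm_infty (B psi)).

(* A Z-periodic graph with one-element fundamental cell: the vertex set is Z,
   [weight k] is the weight of the edge between n and n + k for k <> 0, and
   [potential] is the constant value of Q.  The value [weight 0] is never used. *)
Record periodic_graph := PeriodicGraph {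
  weight : Z -> R;
  potential : R;
  weight_ge0 : forall k : Z, k <> 0%Z -> 0 <= weight k;
  weight_sym : forall k : Z, k <> 0%Z -> weight (- k)%Z = weight k;
  weight_summable :
    summableZ (fun k => if Z.eq_dec k 0 then 0 else weight k);
  potential_ge0 : 0 <= potential
}.

Definition schrodinger (G : periodic_graph) (psi : Z -> C) : Z -> C :=
  fun n =>
    (CsumZ (fun k => if Z.eq_dec k 0 then 0 else weight G k * psi (n + k)%Z)
     + potential G * psi n)%C.

Definition cis (x : R) : C := (cos x, sin x).

(* A function on R/Z enters only through its values on [0,1]. *)
Definition fourier_coeff (h : R -> R) (k : Z) : C :=
  RInt (V := C_R_CompleteNormedModule)
    (fun theta => (h theta * cis (- (2 * PI * IZR k * theta)))%C) 0 1.

Definition defined_by (G : periodic_graph) (h : R -> R) : Prop :=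
  fourier_coeff h 0 = RtoC (potential G) /\
  (forall k : Z, k <> 0%Z -> fourier_coeff h k = RtoC (weight G k)).

Definition op_pow (A : (Z -> C) -> (Z -> C)) (k : nat) (psi : Z -> C) : Z -> C :=
  Nat.iter k A psi.

Definition exp_partial (A : (Z -> C) -> (Z -> C)) (N : nat) (psi : Z -> C) :
    Z -> C :=
  fun n => sum_n (G := C_AbelianMonoid)
    (fun k => (op_pow A k psi n / INR (fact k))%C) N.

(* [E] is the sum of the series of the [A ^ k / k!], for the operator norm of
   bounded operators on l2(Z). *)
Definition is_op_exp (A E : (Z -> C) -> (Z -> C)) : Prop :=
  forall eps : R, 0 < eps -> exists N0 : nat, forall N : nat, (N0 <= N)%nat ->
  forall psi : Z -> C, in_l2 psi ->
    in_l2 (exp_partial A N psi) /\ in_l2 (E psi) /\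
    norm2 (fun n => exp_partial A N psi n - E psi n)%C <= eps * norm2 psi.

(* For [A] bounded on l2(Z) such an [E] exists and is unique on l2(Z). *)
Definition op_exp (A : (Z -> C) -> (Z -> C)) : (Z -> C) -> (Z -> C) :=
  epsilon (inhabits (fun psi : Z -> C => psi)) (is_op_exp A).

Definition propagator (G : periodic_graph) (t : R) : (Z -> C) -> (Z -> C) :=
  op_exp (fun psi n => (Ci * t * schrodinger G psi n)%C).

Lemma IZR_sqr_ge1 (k : Z) : k <> 0%Z -> 1 <= IZR k * IZR k.
Proof. intros Hk; rewrite <- mult_IZR; apply IZR_le; nia. Qed.

Lemma ex_series_inv_sq : ex_series (fun j : nat => / (INR (S j) * INR (S j))).
Proof.
apply (@ex_series_le R_AbsRing R_CompleteNormedModule _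
  (fun j => 2 * (/ INR (S j) - / INR (S (S j))))).
- intros j; rewrite !S_INR; assert (H := pos_INR j).
  change (norm ?x) with (Rabs x); rewrite Rabs_pos_eq.
  + apply Rmult_le_reg_r
      with ((INR j + 1) * (INR j + 1) * (INR j + 1 + 1)); [nra|].
    field_simplify; nra.
  + apply Rlt_le, Rinv_0_lt_compat; nra.
- exists 2; change (is_lim_seq
    (sum_n (fun j => 2 * (/ INR (S j) - / INR (S (S j))))) 2).
  apply is_lim_seq_ext with (fun n => 2 - 2 * / INR (S (S n))).
  + intros n; induction n as [|n IH].
    * rewrite sum_O; simpl; field.
    * rewrite sum_Sn, <- IH; change plus with Rplus; rewrite !S_INR.
      assert (H := pos_INR n); field; lra.
  + replace (Finite 2) with (Finite (2 - 2 * 0)) by (f_equal; ring).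
    apply is_lim_seq_minus'; [apply is_lim_seq_const|].
    apply is_lim_seq_mult'; [apply is_lim_seq_const|].
    apply is_lim_seq_ext with (fun n => / INR (n + 2)).
    { intros n; do 2 f_equal; lia. }
    apply (is_lim_seq_incr_n (fun n => / INR n) 2).
    replace (Finite 0) with (Rbar_inv p_infty) by reflexivity.
    apply is_lim_seq_inv; [apply is_lim_seq_INR | discriminate].
Qed.

Lemma summableZ_inv_sq (c : R) (f : Z -> R) :
  (forall k, k <> 0%Z -> Rabs (f k) <= c * / (IZR k * IZR k)) -> summableZ f.
Proof.
intros Hf.
assert (Hs : ex_series (fun j : nat => c * / (INR (S j) * INR (S j)))).
{ exact (@ex_series_scal R_AbsRing R_NormedModule c _ ex_series_inv_sq). }
split.
- apply ex_series_incr_1.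
  refine (@ex_series_le R_AbsRing R_CompleteNormedModule _ _ _ Hs).
  intros j; change (norm ?x) with (Rabs x); rewrite Rabs_Rabsolu.
  rewrite INR_IZR_INZ; apply Hf; lia.
- refine (@ex_series_le R_AbsRing R_CompleteNormedModule _ _ _ Hs).
  intros j; change (norm ?x) with (Rabs x); rewrite Rabs_Rabsolu.
  rewrite INR_IZR_INZ.
  refine (Rle_trans _ _ _ (Hf _ _) _); [lia|].
  rewrite opp_IZR; right; do 2 f_equal; ring.
Qed.

Lemma fourier_coeff_parabola0 :
  fourier_coeff (fun theta => (theta - 1 / 2) ^ 2) 0 = RtoC (1 / 12).
Proof.
apply (@is_RInt_unique C_R_CompleteNormedModule).
apply (@is_RInt_ext C_R_NormedModule
         (fun theta => ((theta - 1 / 2) ^ 2, 0) : C)).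
{ intros x _; unfold cis, Cmult, RtoC; simpl.
  replace (- (2 * PI * 0 * x)) with 0 by ring; rewrite cos_0, sin_0.
  apply injective_projections; simpl; ring. }
apply (@is_RInt_fct_extend_pair R_NormedModule R_NormedModule); simpl.
- replace (1 / 12) with
    (minus ((1 - 1 / 2) ^ 3 / 3) ((0 - 1 / 2) ^ 3 / 3))
    by (unfold minus, plus, opp; simpl; field).
  apply (@is_RInt_derive R_CompleteNormedModule
           (fun x => (x - 1 / 2) ^ 3 / 3)).
  + intros x _; auto_derive; [trivial | field].
  + intros x _; apply (@ex_derive_continuous R_AbsRing R_NormedModule);
    auto_derive; trivial.
- evar_last; [apply (@is_RInt_const R_NormedModule)|].
  unfold scal; simpl; unfold mult; simpl; ring.
Qed.

Lemma fourier_coeff_parabola (k : Z) : k <> 0%Z ->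
  fourier_coeff (fun theta => (theta - 1 / 2) ^ 2) k
  = RtoC (1 / (2 * PI ^ 2 * (IZR k * IZR k))).
Proof.
intros Hk.
assert (HP := PI_RGT_0).
assert (HK : IZR k <> 0) by (intro H; apply Hk, eq_IZR; exact H).
set (a := 2 * PI * IZR k).
assert (Ha : a <> 0) by (unfold a; apply Rmult_integral_contrapositive; lra).
assert (Hc : cos (- (a * 1)) = 1 /\ sin (- (a * 1)) = 0).
{ rewrite cos_neg, sin_neg, Rmult_1_r; unfold a.
  assert (Hs : sin (IZR k * PI) = 0) by (apply sin_eq_0_1; exists k; ring).
  replace (2 * PI * IZR k) with (2 * (IZR k * PI)) by ring.
  rewrite cos_2a_sin, sin_2a, Hs; split; ring. }
destruct Hc as [Hc Hs].
assert (Hc0 : cos (- (a * 0)) = 1) by (rewrite Rmult_0_r, Ropp_0; apply cos_0).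
assert (Hs0 : sin (- (a * 0)) = 0) by (rewrite Rmult_0_r, Ropp_0; apply sin_0).
apply (@is_RInt_unique C_R_CompleteNormedModule).
apply (@is_RInt_ext C_R_NormedModule
         (fun x => ((x - 1 / 2) ^ 2 * cos (- (a * x)),
                    (x - 1 / 2) ^ 2 * sin (- (a * x))) : C)).
{ intros x _; unfold cis, Cmult, RtoC, a.
  apply injective_projections; simpl; ring. }
apply (@is_RInt_fct_extend_pair R_NormedModule R_NormedModule); simpl fst;
  simpl snd.
- set (F := fun x => - (x - 1 / 2) ^ 2 * sin (- (a * x)) / a
                     + 2 * (x - 1 / 2) * cos (- (a * x)) / a ^ 2
                     + 2 * sin (- (a * x)) / a ^ 3).
  replace (1 / (2 * PI ^ 2 * (IZR k * IZR k))) with (minus (F 1) (F 0)).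
  + apply (@is_RInt_derive R_CompleteNormedModule F).
    * intros x _; unfold F; auto_derive; [trivial | field; exact Ha].
    * intros x _; apply (@ex_derive_continuous R_AbsRing R_NormedModule);
      auto_derive; trivial.
  + unfold minus, plus, opp, F; simpl; rewrite Hc, Hs, Hc0, Hs0.
    unfold a; field; split; [exact HK | lra].
- set (F := fun x => (x - 1 / 2) ^ 2 * cos (- (a * x)) / a
                     + 2 * (x - 1 / 2) * sin (- (a * x)) / a ^ 2
                     - 2 * cos (- (a * x)) / a ^ 3).
  evar_last.
  + apply (@is_RInt_derive R_CompleteNormedModule F).
    * intros x _; unfold F; auto_derive; [trivial | field; exact Ha].
    * intros x _; apply (@ex_derive_continuous R_AbsRing R_NormedModule);
      auto_derive; trivial.
  + unfold minus, plus, opp, F; simpl; rewrite Hc, Hs, Hc0, Hs0.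
    field; exact Ha.
Qed.

(* The graph of the parabola exists: its Fourier coefficients are
   non-negative, symmetric and summable. *)
Lemma parabola_graph_exists :
  exists G : periodic_graph,
    defined_by G (fun theta => (theta - 1 / 2) ^ 2).
Proof.
assert (HP := PI_RGT_0).
set (w := fun k => 1 / (2 * PI ^ 2 * (IZR k * IZR k))).
assert (Hw : forall k, k <> 0%Z -> 0 <= w k).
{ intros k Hk; assert (H := IZR_sqr_ge1 Hk).
  unfold w; apply Rlt_le, Rdiv_lt_0_compat; [lra|].
  assert (0 < PI ^ 2) by nra; nra. }
assert (Hsym : forall k, k <> 0%Z -> w (- k)%Z = w k).
{ intros k Hk; unfold w; rewrite opp_IZR; do 2 f_equal; ring. }
assert (Hsum : summableZ (fun k => if Z.eq_dec k 0 then 0 else w k)).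
{ apply summableZ_inv_sq with (1 / (2 * PI ^ 2)).
  intros k Hk; destruct (Z.eq_dec k 0) as [|_]; [contradiction|].
  rewrite Rabs_pos_eq by auto.
  right; unfold w; field; split; [|lra].
  intro H; apply Hk, eq_IZR; exact H. }
assert (H12 : 0 <= 1 / 12) by lra.
exists (PeriodicGraph Hw Hsym Hsum H12); split.
- exact fourier_coeff_parabola0.
- intros k Hk; exact (fourier_coeff_parabola Hk).
Qed.

(* Main.v *)
Require Import Defs.
From Stdlib Require Import Reals ZArith Lra Lia FunctionalExtensionality ClassicalEpsilon.
From Coquelicot Require Import Coquelicot.

(** The propagator is convolution with the oscillatory integrals
    [K_j = int_0^1 exp (i t h(x)) cos (2 pi j x) dx], because [A^k delta_m] is
    given by the moments [int_0^1 h(x)^k cos (2 pi j x) dx]: multiplying by [h]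
    amounts to convolving with its Fourier coefficients.  Completing the square,
    [t h(x) + 2 pi j x] is [t u^2] plus a constant, so every [K_j] is a Fresnel
    integral over a unit interval; cutting out the window [|u| <= t^(-1/2)] and
    integrating by parts outside gives [O(t^(-1/2))] uniformly in [j].  The same
    splitting bounds [K_0] from below by a multiple of [t^(-1/2)], and [K_0] is
    the diagonal entry of the propagator. *)

Local Open Scope R_scope.

(** * Sums over the integers *)

(** [op_exp] is chosen by [epsilon] and characterised only by operator-norm convergence on l^2,
    whereas moments give pointwise values on point masses. The bridge is a Minkowski inequality for
    weighted superpositions: it bounds the powers of the operator and the tail of the exponential
    series on l^2, so the pointwise sum [exp_sum] is an exponential and agrees with the chosen one.
    Multiplication by h becomes convolution only once the Fourier series of the parabola is known to
    converge to it. This is shown by hand: integrating the Dirichlet kernel makes the error of the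
    partial sums constant in the limit on (0,1), and every such error has mean zero. The passage
    from point masses to all of l^1 rests on a cruder fact, boundedness of the exponential on
    bounded sequences, which absorbs the truncation error. The constant 8 is 4 + 4 for real and
    imaginary parts; in units of t^(-1/2), each 4 is 2 for the length of the window plus 1 for each
    side of it. *)

Lemma summableZ_ex_series (f : Z -> R) : summableZ f ->
  ex_series (fun j : nat => f (Z.of_nat j)) /\
  ex_series (fun j : nat => f (- Z.of_nat (S j))%Z).
Proof. intros [H1 H2]; split; apply ex_series_Rabs; assumption. Qed.

Lemma summableZ_le (f g : Z -> R) :
  (forall k, Rabs (f k) <= g k) -> summableZ g -> summableZ f.
Proof.
intros H Hg; destruct (summableZ_ex_series _ Hg) as [H1 H2]; split;
 [refine (@ex_series_le R_AbsRing R_CompleteNormedModule _ _ _ H1)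
 |refine (@ex_series_le R_AbsRing R_CompleteNormedModule _ _ _ H2)];
 intros j; change (norm ?x) with (Rabs x); rewrite Rabs_Rabsolu; apply H.
Qed.

Lemma summableZ_abs (f : Z -> R) : summableZ f -> summableZ (fun k => Rabs (f k)).
Proof.
intros [H1 H2]; split; [revert H1|revert H2]; apply ex_series_ext; intros j;
 now rewrite Rabs_Rabsolu.
Qed.

Lemma summableZ_plus (f g : Z -> R) :
  summableZ f -> summableZ g -> summableZ (fun k => f k + g k).
Proof.
intros Hf Hg.
destruct Hf as [F1 F2], Hg as [G1 G2]; split.
- refine (@ex_series_le R_AbsRing R_CompleteNormedModule _ _ _
    (@ex_series_plus R_AbsRing R_NormedModule _ _ F1 G1)).
  intros j; change (norm ?x) with (Rabs x); rewrite Rabs_Rabsolu; apply Rabs_triang.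
- refine (@ex_series_le R_AbsRing R_CompleteNormedModule _ _ _
    (@ex_series_plus R_AbsRing R_NormedModule _ _ F2 G2)).
  intros j; change (norm ?x) with (Rabs x); rewrite Rabs_Rabsolu; apply Rabs_triang.
Qed.

Lemma summableZ_scal (c : R) (f : Z -> R) :
  summableZ f -> summableZ (fun k => c * f k).
Proof.
intros [H1 H2].
apply (@ex_series_scal R_AbsRing R_NormedModule (Rabs c)) in H1.
apply (@ex_series_scal R_AbsRing R_NormedModule (Rabs c)) in H2.
split; [revert H1|revert H2]; apply ex_series_ext; intros j; symmetry;
 apply Rabs_mult.
Qed.

Lemma summableZ_ext (f g : Z -> R) :
  (forall k, f k = g k) -> summableZ f -> summableZ g.
Proof. intros H; now replace g with f by (apply functional_extensionality; exact H). Qed.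

Lemma sumZ_ext (f g : Z -> R) : (forall k, f k = g k) -> sumZ f = sumZ g.
Proof. intros H; now replace g with f by (apply functional_extensionality; exact H). Qed.

Lemma sumZ_plus (f g : Z -> R) : summableZ f -> summableZ g ->
  sumZ (fun k => f k + g k) = sumZ f + sumZ g.
Proof.
intros Hf Hg.
destruct (summableZ_ex_series _ Hf) as [F1 F2].
destruct (summableZ_ex_series _ Hg) as [G1 G2].
unfold sumZ; rewrite (Series_plus _ _ F1 G1), (Series_plus _ _ F2 G2); ring.
Qed.

Lemma sumZ_scal (c : R) (f : Z -> R) : sumZ (fun k => c * f k) = c * sumZ f.
Proof. unfold sumZ; rewrite !Series_scal_l; ring. Qed.

Lemma sumZ_le (f g : Z -> R) : summableZ f -> summableZ g ->
  (forall k, f k <= g k) -> sumZ f <= sumZ g.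
Proof.
assert (Hpos : forall h, summableZ h -> (forall k, 0 <= h k) -> 0 <= sumZ h).
{ intros h Hh H; destruct (summableZ_ex_series _ Hh) as [H1 H2].
  assert (Z0 : Series (fun _ : nat => 0) = 0).
  { rewrite (Series_ext _ (fun n : nat => 0 * 0)) by (intros; ring).
    rewrite Series_scal_l; ring. }
  unfold sumZ; apply Rplus_le_le_0_compat; rewrite <- Z0; apply Series_le; auto;
  intros; split; try lra; apply H. }
intros Hf Hg H.
assert (Hm := summableZ_scal (-1) _ Hf).
assert (H0 := Hpos _ (summableZ_plus _ _ Hg Hm)).
cbv beta in H0; rewrite (sumZ_plus _ _ Hg Hm), sumZ_scal in H0.
assert (0 <= sumZ g + -1 * sumZ f); [apply H0; intros k; specialize (H k); lra | lra].
Qed.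

Lemma sumZ_zero : sumZ (fun _ => 0) = 0.
Proof.
rewrite (sumZ_ext _ (fun n => 0 * 0)) by (intros; ring).
rewrite sumZ_scal; ring.
Qed.

Lemma summableZ_zero : summableZ (fun _ => 0).
Proof. apply summableZ_inv_sq with 0; intros; rewrite Rabs_R0; lra. Qed.

Lemma sumZ_ge0 (f : Z -> R) : summableZ f -> (forall k, 0 <= f k) -> 0 <= sumZ f.
Proof.
intros Hf H; rewrite <- sumZ_zero; apply sumZ_le; auto using summableZ_zero.
Qed.

Lemma summableZ_shift1 (f : Z -> R) : summableZ f -> summableZ (fun k => f (k + 1)%Z).
Proof.
intros [H1 H2]; split.
- apply (@ex_series_incr_1 R_AbsRing R_NormedModule) in H1; revert H1.
  apply ex_series_ext; intros j; do 2 f_equal; lia.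
- apply (@ex_series_incr_1 R_AbsRing R_NormedModule); revert H2.
  apply ex_series_ext; intros j; do 2 f_equal; lia.
Qed.

Lemma sumZ_shift1 (f : Z -> R) : summableZ f -> sumZ (fun k => f (k + 1)%Z) = sumZ f.
Proof.
intros Hf; assert (Hs := summableZ_shift1 _ Hf).
destruct (summableZ_ex_series _ Hf) as [F1 F2].
destruct (summableZ_ex_series _ Hs) as [G1 G2].
(* The shift moves only the term [f 0] from the first half-series to the second, so it is split off
   on both sides. *)
unfold sumZ; rewrite (Series_incr_1 _ F1), (Series_incr_1 _ G2).
replace (- Z.of_nat 1 + 1)%Z with 0%Z by lia; change (Z.of_nat 0) with 0%Z.
rewrite (Series_ext (fun k => f (Z.of_nat k + 1)%Z) (fun k => f (Z.of_nat (S k))))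
  by (intros; f_equal; lia).
rewrite (Series_ext (fun k => f (- Z.of_nat (S (S k)) + 1)%Z)
    (fun k => f (- Z.of_nat (S k))%Z))
  by (intros; f_equal; lia).
ring.
Qed.

(** The reflection [k -> - k - 1], unlike [k -> - k], exchanges the two half-series of [sumZ] term
    by term. Conjugating by it turns a negative shift into a positive one. *)
Lemma summableZ_reflect (f : Z -> R) :
  summableZ f -> summableZ (fun k => f (- k - 1)%Z).
Proof.
intros [H1 H2]; split; [revert H2|revert H1]; apply ex_series_ext; intros j;
 do 2 f_equal; lia.
Qed.

Lemma sumZ_reflect (f : Z -> R) : sumZ (fun k => f (- k - 1)%Z) = sumZ f.
Proof.
unfold sumZ; rewrite Rplus_comm; f_equal; apply Series_ext; intros j; f_equal; lia.
Qed.

Lemma sumZ_shift_nat (f : Z -> R) (m : nat) : summableZ f ->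
  summableZ (fun k => f (k + Z.of_nat m)%Z) /\
  sumZ (fun k => f (k + Z.of_nat m)%Z) = sumZ f.
Proof.
intros Hf; induction m as [|m [IH1 IH2]].
- split; [revert Hf; apply summableZ_ext|apply sumZ_ext]; intros k; f_equal; lia.
- assert (E : forall k, f (k + 1 + Z.of_nat m)%Z = f (k + Z.of_nat (S m))%Z)
    by (intros k; f_equal; lia).
  split; [apply (summableZ_ext _ _ E), (summableZ_shift1 _ IH1)|].
  rewrite <- IH2, <- (sumZ_shift1 _ IH1); symmetry; apply sumZ_ext, E.
Qed.

Lemma sumZ_shift (f : Z -> R) (m : Z) : summableZ f ->
  summableZ (fun k => f (k + m)%Z) /\ sumZ (fun k => f (k + m)%Z) = sumZ f.
Proof.
intros Hf; destruct (Z_le_gt_dec 0 m) as [Hm|Hm].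
- rewrite <- (Z2Nat.id m Hm); apply sumZ_shift_nat, Hf.
- destruct (sumZ_shift_nat _ (Z.to_nat (- m)) (summableZ_reflect _ Hf)) as [H1 H2].
  assert (E : forall k, f (- (- k - 1 + Z.of_nat (Z.to_nat (- m))) - 1)%Z = f (k + m)%Z)
    by (intros k; f_equal; lia).
  split; [apply (summableZ_ext _ _ E), (summableZ_reflect _ H1)|].
  rewrite <- (sumZ_reflect f), <- H2.
  rewrite <- (sumZ_reflect (fun k => f (- (k + Z.of_nat (Z.to_nat (- m))) - 1)%Z)).
  symmetry; apply sumZ_ext, E.
Qed.

(** The window runs over the integers from [- (N + 1)] to [N], so both half-series are cut after the
    same number of terms. Bounding all windows of a nonnegative family yields its summability and
    its sum at once. *)
Definition windowZ (f : Z -> R) (N : nat) : R :=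
  sum_n (fun j => f (Z.of_nat j)) N + sum_n (fun j => f (- Z.of_nat (S j))%Z) N.

Lemma windowZ_S (f : Z -> R) (N : nat) : windowZ f (S N) =
  windowZ f N + f (Z.of_nat (S N)) + f (- Z.of_nat (S (S N)))%Z.
Proof. unfold windowZ; rewrite !sum_Sn; change plus with Rplus; ring. Qed.

Lemma windowZ_0 (f : Z -> R) : windowZ f 0 = f 0%Z + f (-1)%Z.
Proof. unfold windowZ; rewrite !sum_O; reflexivity. Qed.

Lemma windowZ_scal (c : R) (f : Z -> R) (N : nat) :
  windowZ (fun k => c * f k) N = c * windowZ f N.
Proof.
induction N as [|N IH]; [unfold windowZ; rewrite !sum_O; ring|].
rewrite !windowZ_S, IH; ring.
Qed.

Lemma windowZ_le (f g : Z -> R) (N : nat) : (forall k, f k <= g k) ->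
  windowZ f N <= windowZ g N.
Proof.
intros H; induction N as [|N IH].
- unfold windowZ; rewrite !sum_O; apply Rplus_le_compat; apply H.
- rewrite !windowZ_S; apply Rplus_le_compat; [apply Rplus_le_compat|]; auto.
Qed.

Lemma series_of_bounded (a : nat -> R) (M : R) :
  (forall n, 0 <= a n) -> (forall N, sum_n a N <= M) -> ex_series a.
Proof.
intros Ha HM; destruct (ex_finite_lim_seq_incr (sum_n a) M) as [l Hl]; auto.
- intros n; rewrite sum_Sn; change plus with Rplus; specialize (Ha (S n)); lra.
- exists l; exact Hl.
Qed.

Lemma windowZ_lim (f : Z -> R) : summableZ f -> is_lim_seq (windowZ f) (sumZ f).
Proof.
intros Hf; destruct (summableZ_ex_series _ Hf) as [H1 H2].
apply (is_lim_seq_plus' _ _ _ _ (Series_correct _ H1) (Series_correct _ H2)).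
Qed.

Lemma windowZ_le_sumZ (f : Z -> R) (N : nat) : summableZ f ->
  (forall k, 0 <= f k) -> windowZ f N <= sumZ f.
Proof.
intros Hf H.
apply (is_lim_seq_incr_compare _ _ (windowZ_lim _ Hf)).
intros n; rewrite windowZ_S.
assert (H1 := H (Z.of_nat (S n))); assert (H2 := H (- Z.of_nat (S (S n)))%Z); lra.
Qed.

Lemma summableZ_of_window (f : Z -> R) (M : R) :
  (forall k, 0 <= f k) -> (forall N, windowZ f N <= M) -> summableZ f /\ sumZ f <= M.
Proof.
intros H HM.
assert (Hs : summableZ f).
{ apply summableZ_le with f; [intros; rewrite Rabs_pos_eq; auto; lra|].
  assert (P1 : forall N, 0 <= sum_n (fun j => f (Z.of_nat j)) N).
  { intros N; induction N as [|N IH]; rewrite ?sum_O, ?sum_Sn; auto.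
    apply Rplus_le_le_0_compat; auto. }
  assert (P2 : forall N, 0 <= sum_n (fun j => f (- Z.of_nat (S j))%Z) N).
  { intros N; induction N as [|N IH]; rewrite ?sum_O, ?sum_Sn; auto.
    apply Rplus_le_le_0_compat; auto. }
  split; (eapply ex_series_ext; [intros; symmetry; apply Rabs_pos_eq, H|]);
   apply series_of_bounded with M; auto; intros N;
   specialize (HM N); specialize (P1 N); specialize (P2 N); unfold windowZ in HM; lra. }
split; [exact Hs|].
apply (is_lim_seq_le (windowZ f) (fun _ => M) (sumZ f) M HM).
- apply windowZ_lim, Hs.
- apply is_lim_seq_const.
Qed.

Lemma le_sumZ (f : Z -> R) (n : Z) : summableZ f -> (forall k, 0 <= f k) -> f n <= sumZ f.
Proof.
(* Translating [n] to the origin places the term inside the smallest window. *)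
intros Hf H; destruct (sumZ_shift _ n Hf) as [Hs <-].
refine (Rle_trans _ _ _ _ (windowZ_le_sumZ _ 0 Hs (fun k => H (k + n)%Z))).
unfold windowZ; rewrite !sum_O; change (Z.of_nat 0 + n)%Z with n.
specialize (H (- Z.of_nat 1 + n)%Z); lra.
Qed.

(** With one of the sums cut to a window, exchanging them is finite additivity. Together with
    [summableZ_of_window] this does the work of Tonelli's theorem. *)
Lemma sumZ_exchange_window (F : Z -> Z -> R) (N : nat) :
  (forall n, summableZ (fun k => F k n)) ->
  summableZ (fun k => windowZ (F k) N) /\
  windowZ (fun n => sumZ (fun k => F k n)) N = sumZ (fun k => windowZ (F k) N).
Proof.
intros H; induction N as [|N [IH1 IH2]].
- assert (E : forall k, F k 0%Z + F k (-1)%Z = windowZ (F k) 0)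
    by (intros; symmetry; apply windowZ_0).
  split; [apply (summableZ_ext _ _ E), summableZ_plus; apply H|].
  rewrite windowZ_0, <- sumZ_plus by apply H; apply sumZ_ext, E.
- assert (E : forall k, windowZ (F k) N + F k (Z.of_nat (S N))
      + F k (- Z.of_nat (S (S N)))%Z = windowZ (F k) (S N))
    by (intros; symmetry; apply windowZ_S).
  assert (S1 := summableZ_plus _ _ IH1 (H (Z.of_nat (S N)))).
  assert (S2 := H (- Z.of_nat (S (S N)))%Z).
  split; [apply (summableZ_ext _ _ E), (summableZ_plus _ _ S1 S2)|].
  rewrite windowZ_S, IH2, <- (sumZ_plus _ _ IH1 (H _)), <- (sumZ_plus _ _ S1 S2).
  apply sumZ_ext, E.
Qed.

(** * Weighted Cauchy-Schwarz and Minkowski inequalities *)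

Lemma summableZ_mult_bounded (w g : Z -> R) (K : R) : summableZ w ->
  (forall k, Rabs (g k) <= K) -> summableZ (fun k => w k * g k).
Proof.
intros Hw Hg; apply summableZ_le with (fun k => K * Rabs (w k)).
- intros k; rewrite Rabs_mult, Rmult_comm; apply Rmult_le_compat_r; auto using Rabs_pos.
- apply summableZ_scal, summableZ_abs, Hw.
Qed.

Lemma weighted_cauchy_schwarz (w g : Z -> R) (W K : R) :
  (forall k, 0 <= w k) -> summableZ w -> sumZ w <= W -> 0 < W ->
  (forall k, Rabs (g k) <= K) ->
  sumZ (fun k => w k * g k) ^ 2 <= W * sumZ (fun k => w k * g k ^ 2).
Proof.
intros Hw Sw HW HW0 Hg.
assert (S1 := summableZ_mult_bounded w g K Sw Hg).
assert (S2 : summableZ (fun k => w k * g k ^ 2)).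
{ apply summableZ_mult_bounded with (K ^ 2); auto.
  intros k; rewrite <- RPow_abs; apply pow_incr; auto using Rabs_pos. }
set (m := sumZ (fun k => w k * g k)) in *; set (q := sumZ (fun k => w k * g k ^ 2)) in *.
(* The weighted variance of [g] around [m / W] is nonnegative. *)
assert (HV : 0 <= q + (-2 * (m / W)) * m + (m / W) ^ 2 * sumZ w).
{ unfold q, m at 2; rewrite <- !sumZ_scal, <- !sumZ_plus;
    auto using summableZ_plus, summableZ_scal.
  apply sumZ_ge0; auto using summableZ_plus, summableZ_scal.
  intros k; replace (_ + _) with (w k * (g k - m / W) ^ 2) by ring.
  apply Rmult_le_pos; [auto|apply pow2_ge_0]. }
assert (H : (m / W) ^ 2 * sumZ w <= (m / W) ^ 2 * W)
  by (apply Rmult_le_compat_l; [apply pow2_ge_0|exact HW]).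
replace ((m / W) ^ 2 * W) with (m ^ 2 / W) in H by (field; lra).
replace (-2 * (m / W) * m) with (-2 * (m ^ 2 / W)) in HV by (field; lra).
replace (m ^ 2) with (W * (m ^ 2 / W)) by (field; lra).
apply Rmult_le_compat_l; lra.
Qed.

Lemma Cmod_sqr (z : C) : Cmod z ^ 2 = Re z ^ 2 + Im z ^ 2.
Proof.
unfold Cmod, Re, Im; rewrite pow2_sqrt; [reflexivity|].
apply Rplus_le_le_0_compat; apply pow2_ge_0.
Qed.

Lemma Rabs_Re_le (z : C) : Rabs (Re z) <= Cmod z.
Proof. eapply Rle_trans; [apply Rmax_l|apply Rmax_Cmod]. Qed.

Lemma Rabs_Im_le (z : C) : Rabs (Im z) <= Cmod z.
Proof. eapply Rle_trans; [apply Rmax_r|apply Rmax_Cmod]. Qed.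

Lemma sqr_le_abs (x y : R) : 0 <= y -> x ^ 2 <= y ^ 2 -> Rabs x <= y.
Proof. intros Hy H; apply Rabs_le; split; nra. Qed.

Lemma Cmod_le_of_sqr (z : C) (y : R) : 0 <= y -> Cmod z ^ 2 <= y ^ 2 -> Cmod z <= y.
Proof.
intros Hy H; rewrite <- (Rabs_pos_eq (Cmod z)) by apply Cmod_ge_0; now apply sqr_le_abs.
Qed.

Lemma Re_CsumZ (w : Z -> R) (z : Z -> C) :
  Re (CsumZ (fun k => w k * z k)%C) = sumZ (fun k => w k * Re (z k)).
Proof. apply sumZ_ext; intros k; unfold Re; simpl; ring. Qed.

Lemma Im_CsumZ (w : Z -> R) (z : Z -> C) :
  Im (CsumZ (fun k => w k * z k)%C) = sumZ (fun k => w k * Im (z k)).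
Proof. apply sumZ_ext; intros k; unfold Im; simpl; ring. Qed.

Lemma Cmod_CsumZ_sqr_le (w : Z -> R) (z : Z -> C) (W K : R) :
  (forall k, 0 <= w k) -> summableZ w -> sumZ w <= W -> 0 < W ->
  (forall k, Cmod (z k) <= K) ->
  Cmod (CsumZ (fun k => w k * z k)%C) ^ 2 <= W * sumZ (fun k => w k * Cmod (z k) ^ 2).
Proof.
intros Hw Sw HW HW0 Hz.
rewrite Cmod_sqr, Re_CsumZ, Im_CsumZ.
rewrite (sumZ_ext (fun k => w k * Cmod (z k) ^ 2)
  (fun k => w k * Re (z k) ^ 2 + w k * Im (z k) ^ 2))
  by (intros; rewrite Cmod_sqr; ring).
assert (H1 : forall k, Rabs (Re (z k)) <= K)
  by (intros; eapply Rle_trans; [apply Rabs_Re_le|auto]).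
assert (H2 : forall k, Rabs (Im (z k)) <= K)
  by (intros; eapply Rle_trans; [apply Rabs_Im_le|auto]).
rewrite sumZ_plus.
- rewrite Rmult_plus_distr_l; apply Rplus_le_compat;
   apply weighted_cauchy_schwarz with K; auto.
- apply summableZ_mult_bounded with (K ^ 2); auto.
  intros k; rewrite <- RPow_abs; apply pow_incr; auto using Rabs_pos.
- apply summableZ_mult_bounded with (K ^ 2); auto.
  intros k; rewrite <- RPow_abs; apply pow_incr; auto using Rabs_pos.
Qed.

(** Minkowski's inequality for a superposition with nonnegative weights of mass at most [W], squared
    to avoid roots: Cauchy-Schwarz at each point, then an exchange of sums. It serves twice, for
    convolution (a superposition of translates) and for the tail of the exponential series (a
    superposition of normalised powers). *)
Lemma l2_norm_superposition (w : Z -> R) (f : Z -> Z -> C) (W M : R) :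
  (forall k, 0 <= w k) -> summableZ w -> sumZ w <= W -> 0 < W ->
  (forall k, in_l2 (f k) /\ sumZ (fun n => Cmod (f k n) ^ 2) <= M) ->
  in_l2 (fun n => CsumZ (fun k => w k * f k n)%C) /\
  sumZ (fun n => Cmod (CsumZ (fun k => w k * f k n)%C) ^ 2) <= W ^ 2 * M.
Proof.
intros Hw Sw HW HW0 Hf.
assert (HM : forall k n, Cmod (f k n) ^ 2 <= M).
{ intros k n; destruct (Hf k) as [H1 H2].
  refine (Rle_trans _ _ _ (le_sumZ _ n H1 _) H2); intros; apply pow2_ge_0. }
assert (HM0 : 0 <= M) by (refine (Rle_trans _ _ _ _ (HM 0%Z 0%Z)); apply pow2_ge_0).
(* A crude uniform bound is enough for summability; [M <= (M + 1) ^ 2] spares the square root of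
   [M]. *)
assert (HK : forall k n, Cmod (f k n) <= M + 1)
  by (intros k n; specialize (HM k n); apply Cmod_le_of_sqr; nra).
assert (HP : forall n, Cmod (CsumZ (fun k => w k * f k n)%C) ^ 2
                 <= W * sumZ (fun k => w k * Cmod (f k n) ^ 2))
  by (intros n; apply Cmod_CsumZ_sqr_le with (M + 1); auto).
apply summableZ_of_window; [intros; apply pow2_ge_0|].
intros N; eapply Rle_trans; [apply windowZ_le, HP|].
destruct (sumZ_exchange_window (fun k n => w k * Cmod (f k n) ^ 2) N) as [E1 E2].
{ intros n; apply summableZ_mult_bounded with M; auto.
  intros k; rewrite Rabs_pos_eq; auto using pow2_ge_0. }
rewrite windowZ_scal, E2; simpl (W ^ 2); rewrite Rmult_1_r, Rmult_assoc.
apply Rmult_le_compat_l; [lra|].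
apply Rle_trans with (sumZ (fun k => M * w k)).
- apply sumZ_le; auto using summableZ_scal.
  intros k; rewrite windowZ_scal, Rmult_comm; apply Rmult_le_compat_r; auto.
  destruct (Hf k) as [F1 F2]; refine (Rle_trans _ _ _ _ F2).
  apply windowZ_le_sumZ; auto; intros; apply pow2_ge_0.
- rewrite sumZ_scal, Rmult_comm; apply Rmult_le_compat_r; auto.
Qed.

(** * Exponential of a convolution operator *)

(** Extension by zero, so that a series over the naturals can be fed to [l2_norm_superposition],
    whose weights live on the integers. *)
Definition natZ (a : nat -> R) (k : Z) : R :=
  if (0 <=? k)%Z then a (Z.to_nat k) else 0.

Lemma natZ_of_nat (a : nat -> R) (j : nat) : natZ a (Z.of_nat j) = a j.
Proof.
unfold natZ; rewrite (proj2 (Z.leb_le _ _)) by lia; now rewrite Nat2Z.id.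
Qed.

Lemma natZ_neg (a : nat -> R) (j : nat) : natZ a (- Z.of_nat (S j))%Z = 0.
Proof. unfold natZ; now rewrite (proj2 (Z.leb_gt _ _)) by lia. Qed.

Lemma summableZ_natZ (a : nat -> R) :
  ex_series (fun n => Rabs (a n)) -> summableZ (natZ a).
Proof.
intros H; split.
- revert H; apply ex_series_ext; intros j; now rewrite natZ_of_nat.
- refine (ex_series_ext _ _ _ (proj2 summableZ_zero)); intros j.
  now rewrite natZ_neg.
Qed.

Lemma sumZ_nat_part (f : Z -> R) : (forall j, f (- Z.of_nat (S j))%Z = 0) ->
  sumZ f = Series (fun j => f (Z.of_nat j)).
Proof.
intros H; unfold sumZ.
rewrite (Series_ext (fun j => f (- Z.of_nat (S j))%Z) (fun n : nat => 0 * 0))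
  by (intros j; rewrite H; ring).
rewrite Series_scal_l; ring.
Qed.

Lemma in_l2_le (f : Z -> C) (g : Z -> C) :
  (forall n, Cmod (f n) <= Cmod (g n)) -> in_l2 g -> in_l2 f.
Proof.
intros H; apply summableZ_le; intros n; rewrite Rabs_pos_eq by apply pow2_ge_0.
apply pow_incr; split; auto using Cmod_ge_0.
Qed.

Lemma in_l2_plus (f g : Z -> C) : in_l2 f -> in_l2 g -> in_l2 (fun n => f n + g n)%C.
Proof.
intros Hf Hg.
apply summableZ_le with (fun n => 2 * Cmod (f n) ^ 2 + 2 * Cmod (g n) ^ 2).
- intros n; rewrite Rabs_pos_eq by apply pow2_ge_0.
  assert (H := Cmod_triangle (f n) (g n)); assert (H0 := Cmod_ge_0 (f n + g n)).
  assert (0 <= (Cmod (f n) - Cmod (g n)) ^ 2) by apply pow2_ge_0; nra.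
- apply summableZ_plus; apply summableZ_scal; assumption.
Qed.

Lemma in_l2_minus (f g : Z -> C) : in_l2 f -> in_l2 g -> in_l2 (fun n => f n - g n)%C.
Proof.
intros Hf Hg; apply (in_l2_plus f (fun n => - g n)%C); auto.
apply in_l2_le with g; auto; intros n; rewrite Cmod_opp; lra.
Qed.

Lemma Cmod_le_norm2 (f : Z -> C) (n : Z) : in_l2 f -> Cmod (f n) <= norm2 f.
Proof.
intros Hf; rewrite <- (sqrt_pow2 (Cmod (f n))) by apply Cmod_ge_0.
apply sqrt_le_1_alt, (le_sumZ (fun n => Cmod (f n) ^ 2)); auto.
intros; apply pow2_ge_0.
Qed.

Lemma Re_sum_n (a : nat -> C) (N : nat) :
  Re (sum_n (G := C_AbelianMonoid) a N) = sum_n (fun k => Re (a k)) N.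
Proof.
induction N as [|N IH]; [now rewrite !sum_O|].
rewrite !sum_Sn, <- IH; reflexivity.
Qed.

Lemma Im_sum_n (a : nat -> C) (N : nat) :
  Im (sum_n (G := C_AbelianMonoid) a N) = sum_n (fun k => Im (a k)) N.
Proof.
induction N as [|N IH]; [now rewrite !sum_O|].
rewrite !sum_Sn, <- IH; reflexivity.
Qed.

Lemma Re_div_R (z : C) (x : R) : x <> 0 -> Re (z / x)%C = Re z / x.
Proof. intros H; unfold Re; simpl; field; exact H. Qed.

Lemma Im_div_R (z : C) (x : R) : x <> 0 -> Im (z / x)%C = Im z / x.
Proof. intros H; unfold Im; simpl; field; exact H. Qed.

Definition bounded_by (M : R) (psi : Z -> C) : Prop := forall n, Cmod (psi n) <= M.

(* [i t] times a convolution operator; only the action on bounded sequences is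
   prescribed, since [CsumZ] is junk where the series diverges. *)
Definition is_convolution (A : (Z -> C) -> (Z -> C)) (w : Z -> R) (t : R) : Prop :=
  forall M psi, bounded_by M psi -> forall n,
    A psi n = (Ci * t * CsumZ (fun k => w k * psi (n + k)%Z))%C.

Lemma Cmod_Ci : Cmod Ci = 1.
Proof. unfold Cmod, Ci; simpl; replace (_ + _) with 1 by ring; apply sqrt_1. Qed.

Lemma Cmod_it (t : R) (z : C) : 0 < t -> Cmod (Ci * t * z)%C = t * Cmod z.
Proof.
intros Ht; rewrite !Cmod_mult, Cmod_Ci, Cmod_R, Rabs_pos_eq by lra; ring.
Qed.

Section Exponential.

Variables (A : (Z -> C) -> (Z -> C)) (w : Z -> R) (t W : R).
Hypothesis HA : is_convolution A w t.
Hypothesis w_ge0 : forall k, 0 <= w k.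
Hypothesis w_summable : summableZ w.
Hypothesis w_sum : sumZ w <= W.
Hypothesis W_gt0 : 0 < W.
Hypothesis t_gt0 : 0 < t.

Lemma convolution_bounded (M : R) (psi : Z -> C) :
  bounded_by M psi -> bounded_by (t * W * M) (A psi).
Proof using All.
intros HM n; rewrite (HA M psi HM n), Cmod_it by assumption; rewrite Rmult_assoc.
assert (0 <= M) by (eapply Rle_trans; [apply Cmod_ge_0|apply (HM n)]).
apply Rmult_le_compat_l; [lra|].
(* The sup bound also comes from weighted Cauchy-Schwarz: the squared sum is at most
   [W * (M ^ 2 * W)]. *)
apply Cmod_le_of_sqr; [nra|].
eapply Rle_trans; [apply Cmod_CsumZ_sqr_le with (W := W) (K := M); auto|].
apply Rle_trans with (W * sumZ (fun k => M ^ 2 * w k)).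
- apply Rmult_le_compat_l; [lra|].
  apply sumZ_le; auto using summableZ_scal.
  + apply summableZ_mult_bounded with (M ^ 2); auto.
    intros k; rewrite Rabs_pos_eq by apply pow2_ge_0.
    apply pow_incr; split; auto using Cmod_ge_0.
  + intros k; rewrite (Rmult_comm (M ^ 2)); apply Rmult_le_compat_l; auto.
    apply pow_incr; split; auto using Cmod_ge_0.
- rewrite sumZ_scal; replace ((W * M) ^ 2) with (W * (M ^ 2 * W)) by ring.
  apply Rmult_le_compat_l; [lra|]; apply Rmult_le_compat_l; auto using pow2_ge_0.
Qed.

Lemma convolution_l2 (S : R) (psi : Z -> C) :
  in_l2 psi -> sumZ (fun n => Cmod (psi n) ^ 2) <= S ->
  in_l2 (A psi) /\ sumZ (fun n => Cmod (A psi n) ^ 2) <= (t * W) ^ 2 * S.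
Proof using All.
intros Hpsi HS.
assert (HM : bounded_by (norm2 psi) psi) by (intros n; now apply Cmod_le_norm2).
(* A convolution superposes translates of [psi], all of which have the same l^2 norm. *)
destruct (l2_norm_superposition w (fun k n => psi (n + k)%Z) W S) as [H1 H2]; auto.
{ intros k; destruct (sumZ_shift _ k Hpsi) as [E1 E2]; split; [exact E1|].
  rewrite E2; exact HS. }
assert (E : forall n, t ^ 2 * Cmod (CsumZ (fun k => w k * psi (n + k)%Z)%C) ^ 2
                      = Cmod (A psi n) ^ 2).
{ intros n; rewrite (HA _ _ HM n), Cmod_it by assumption; ring. }
split.
- apply (summableZ_ext _ _ E), summableZ_scal, H1.
- rewrite <- (sumZ_ext _ _ E), sumZ_scal.
  replace ((t * W) ^ 2 * S) with (t ^ 2 * (W ^ 2 * S)) by ring.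
  apply Rmult_le_compat_l; [apply pow2_ge_0|exact H2].
Qed.

Lemma op_pow_bounded (M : R) (psi : Z -> C) (k : nat) :
  bounded_by M psi -> bounded_by ((t * W) ^ k * M) (op_pow A k psi).
Proof using All.
intros HM; induction k as [|k IH]; simpl.
- intros n; rewrite Rmult_1_l; apply HM.
- intros n; rewrite (Rmult_assoc (t * W)); now apply convolution_bounded.
Qed.

Lemma op_pow_l2 (S : R) (psi : Z -> C) (k : nat) :
  in_l2 psi -> sumZ (fun n => Cmod (psi n) ^ 2) <= S ->
  in_l2 (op_pow A k psi) /\
  sumZ (fun n => Cmod (op_pow A k psi n) ^ 2) <= ((t * W) ^ k) ^ 2 * S.
Proof using All.
intros Hpsi HS; induction k as [|k [IH1 IH2]]; simpl op_pow.
- split; [exact Hpsi|]; eapply Rle_trans; [exact HS|right; simpl; ring].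
- destruct (convolution_l2 _ _ IH1 IH2) as [H1 H2]; split; [exact H1|].
  eapply Rle_trans; [exact H2|right]; simpl; ring.
Qed.

(** The common majorant of the exponential series: [(t * W) ^ k] controls the k-th power of [A] both
    in sup norm and on l^2. *)
Definition exp_coeff (k : nat) : R := (t * W) ^ k / INR (fact k).

Lemma exp_coeff_gt0 (k : nat) : 0 < exp_coeff k.
Proof using W_gt0 t_gt0.
apply Rdiv_lt_0_compat; [apply pow_lt; nra|apply INR_fact_lt_0].
Qed.

Lemma is_series_exp_coeff : is_series exp_coeff (exp (t * W)).
Proof.
assert (H := is_exp_Reals (t * W)); unfold is_pseries in H; revert H.
apply is_series_ext; intros k; unfold exp_coeff, scal; simpl; unfold mult; simpl.
now rewrite pow_n_pow.
Qed.

Definition exp_tail (N : nat) : R := Series (fun k => exp_coeff (S N + k)).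

Lemma exp_tail_eq (N : nat) : exp_tail N = exp (t * W) - sum_n exp_coeff N.
Proof.
unfold exp_tail; rewrite <- (is_series_unique _ _ is_series_exp_coeff).
rewrite (Series_incr_n exp_coeff (S N)) by (lia || (eexists; apply is_series_exp_coeff)).
simpl Init.Nat.pred; rewrite sum_n_Reals; ring.
Qed.

Lemma exp_tail_lim : is_lim_seq exp_tail 0.
Proof.
apply is_lim_seq_ext with (fun N => exp (t * W) - sum_n exp_coeff N);
 [intros; symmetry; apply exp_tail_eq|].
replace 0 with (exp (t * W) - exp (t * W)) by ring.
apply is_lim_seq_minus'; [apply is_lim_seq_const|apply is_series_exp_coeff].
Qed.

Lemma ex_series_exp_tail (N : nat) : ex_series (fun k => exp_coeff (S N + k)).
Proof.
apply (@ex_series_incr_n R_AbsRing R_NormedModule exp_coeff).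
eexists; apply is_series_exp_coeff.
Qed.

(** The tail becomes the mass bound in [l2_norm_superposition], which asks for a positive one; one
    more term of the series already makes it so. *)
Lemma exp_tail_gt0 (N : nat) : 0 < exp_tail N.
Proof using W_gt0 t_gt0.
rewrite exp_tail_eq.
assert (H : sum_n exp_coeff (S N) <= exp (t * W)).
{ apply (is_lim_seq_incr_compare _ _ is_series_exp_coeff).
  intros n; rewrite sum_Sn; change plus with Rplus.
  assert (H := exp_coeff_gt0 (S n)); lra. }
rewrite sum_Sn in H; change plus with Rplus in H.
assert (H0 := exp_coeff_gt0 (S N)); lra.
Qed.

(** The pointwise sum of the exponential series, taken in real and imaginary parts because [Series]
    is real. It is meaningful on every bounded sequence, not only on l^2. *)
Definition exp_sum (psi : Z -> C) (n : Z) : C :=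
  (Series (fun k => Re (op_pow A k psi n / INR (fact k))%C),
   Series (fun k => Im (op_pow A k psi n / INR (fact k))%C)).

Lemma Cmod_exp_term (M : R) (psi : Z -> C) (k : nat) (n : Z) :
  bounded_by M psi -> Cmod (op_pow A k psi n / INR (fact k))%C <= M * exp_coeff k.
Proof using All.
intros HM; assert (Hf := INR_fact_lt_0 k).
assert (Hne : RtoC (INR (fact k)) <> 0%C) by (intros E; apply RtoC_inj in E; lra).
rewrite Cmod_div by exact Hne.
rewrite Cmod_R, Rabs_pos_eq by lra; unfold exp_coeff, Rdiv.
rewrite <- Rmult_assoc; apply Rmult_le_compat_r.
- apply Rlt_le, Rinv_0_lt_compat, Hf.
- rewrite Rmult_comm; apply op_pow_bounded, HM.
Qed.

Lemma ex_series_exp_sum (M : R) (psi : Z -> C) (n : Z) : bounded_by M psi ->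
  ex_series (fun k => Re (op_pow A k psi n / INR (fact k))%C) /\
  ex_series (fun k => Im (op_pow A k psi n / INR (fact k))%C).
Proof using All.
intros HM.
assert (He : ex_series (fun k => M * exp_coeff k)).
{ apply (@ex_series_scal R_AbsRing R_NormedModule); eexists; apply is_series_exp_coeff. }
split; refine (@ex_series_le R_AbsRing R_CompleteNormedModule _ _ _ He); intros k;
 change (norm ?x) with (Rabs x); eapply Rle_trans;
 [apply Rabs_Re_le|apply Cmod_exp_term, HM|apply Rabs_Im_le|apply Cmod_exp_term, HM].
Qed.

(** Each term of the tail is split into the weight [exp_coeff] and the power divided by
    [(t * W) ^ k], whose l^2 norm is at most that of [psi]. This is the shape required by
    [l2_norm_superposition]; the minus sign arises because the partial sum minus the full sum is the
    negated tail. *)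
Lemma exp_remainder (M : R) (psi : Z -> C) (N : nat) (n : Z) : bounded_by M psi ->
  (exp_partial A N psi n - exp_sum psi n)%C =
  CsumZ (fun k => natZ (fun j => exp_coeff (S N + j)) k *
    (- (op_pow A (S N + Z.to_nat k) psi n / RtoC ((t * W) ^ (S N + Z.to_nat k)))))%C.
Proof using All.
intros HM; destruct (ex_series_exp_sum M psi n HM) as [H1 H2].
assert (HB : forall k, (t * W) ^ k <> 0) by (intros; apply pow_nonzero; nra).
assert (Hf := INR_fact_neq_0).
apply injective_projections.
- change (Re (exp_partial A N psi n - exp_sum psi n)%C = Re (CsumZ (fun k =>
    natZ (fun j => exp_coeff (S N + j)) k *
    (- (op_pow A (S N + Z.to_nat k) psi n / RtoC ((t * W) ^ (S N + Z.to_nat k)))))%C)).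
  rewrite Re_CsumZ, sumZ_nat_part by (intros; rewrite natZ_neg; ring).
  rewrite (Series_ext _
    (fun j => -1 * Re (op_pow A (S N + j) psi n / INR (fact (S N + j)))%C)).
  + rewrite Series_scal_l.
    change (Re (exp_partial A N psi n) +
      - Series (fun k => Re (op_pow A k psi n / INR (fact k))%C) = 
      -1 * Series (fun j => Re (op_pow A (S N + j) psi n / INR (fact (S N + j)))%C)).
    unfold exp_partial; rewrite Re_sum_n, sum_n_Reals.
    rewrite (Series_incr_n _ (S N) (Nat.lt_0_succ N) H1); simpl Init.Nat.pred.
    unfold C; ring.
  + intros j; rewrite natZ_of_nat, Nat2Z.id.
    change (Re (- ?z)%C) with (- Re z).
    rewrite !Re_div_R by auto; unfold exp_coeff; field; auto.
- change (Im (exp_partial A N psi n - exp_sum psi n)%C = Im (CsumZ (fun k =>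
    natZ (fun j => exp_coeff (S N + j)) k *
    (- (op_pow A (S N + Z.to_nat k) psi n / RtoC ((t * W) ^ (S N + Z.to_nat k)))))%C)).
  rewrite Im_CsumZ, sumZ_nat_part by (intros; rewrite natZ_neg; ring).
  rewrite (Series_ext _
    (fun j => -1 * Im (op_pow A (S N + j) psi n / INR (fact (S N + j)))%C)).
  + rewrite Series_scal_l.
    change (Im (exp_partial A N psi n) +
      - Series (fun k => Im (op_pow A k psi n / INR (fact k))%C) = 
      -1 * Series (fun j => Im (op_pow A (S N + j) psi n / INR (fact (S N + j)))%C)).
    unfold exp_partial; rewrite Im_sum_n, sum_n_Reals.
    rewrite (Series_incr_n _ (S N) (Nat.lt_0_succ N) H2); simpl Init.Nat.pred.
    unfold C; ring.
  + intros j; rewrite natZ_of_nat, Nat2Z.id.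
    change (Im (- ?z)%C) with (- Im z).
    rewrite !Im_div_R by auto; unfold exp_coeff; field; auto.
Qed.

Lemma in_l2_exp_partial (psi : Z -> C) (N : nat) : in_l2 psi -> in_l2 (exp_partial A N psi).
Proof using All.
intros Hpsi.
assert (HT : forall k, in_l2 (fun n => op_pow A k psi n / INR (fact k))%C).
{ intros k; apply in_l2_le with (op_pow A k psi).
  - intros n; assert (Hf := INR_fact_lt_0 k).
    assert (Hne : RtoC (INR (fact k)) <> 0%C) by (intros E; apply RtoC_inj in E; lra).
    rewrite Cmod_div by exact Hne; rewrite Cmod_R, Rabs_pos_eq by lra.
    apply Rle_div_l; [exact Hf|].
    assert (1 <= INR (fact k)) by (apply (le_INR 1); apply Nat.le_succ_l, lt_O_fact).
    assert (H0 := Cmod_ge_0 (op_pow A k psi n)); nra.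
  - apply op_pow_l2 with (sumZ (fun n => Cmod (psi n) ^ 2)); auto; lra. }
induction N as [|N IH].
- refine (summableZ_ext _ _ _ (HT 0%nat)); intros n; unfold exp_partial; now rewrite sum_O.
- refine (summableZ_ext _ _ _ (in_l2_plus _ _ IH (HT (S N)))).
  intros n; unfold exp_partial; now rewrite sum_Sn.
Qed.

Lemma exp_remainder_l2 (psi : Z -> C) (N : nat) : in_l2 psi ->
  in_l2 (fun n => exp_partial A N psi n - exp_sum psi n)%C /\
  sumZ (fun n => Cmod (exp_partial A N psi n - exp_sum psi n)%C ^ 2)
    <= exp_tail N ^ 2 * sumZ (fun n => Cmod (psi n) ^ 2).
Proof using All.
intros Hpsi.
assert (HM : bounded_by (norm2 psi) psi) by (intros n; now apply Cmod_le_norm2).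
assert (HB : forall k, 0 < (t * W) ^ k) by (intros; apply pow_lt; nra).
set (f := fun (k n : Z) => (- (op_pow A (S N + Z.to_nat k) psi n
   / RtoC ((t * W) ^ (S N + Z.to_nat k))))%C).
destruct (l2_norm_superposition (natZ (fun j => exp_coeff (S N + j))) f (exp_tail N)
  (sumZ (fun n => Cmod (psi n) ^ 2))) as [H1 H2].
- intros k; unfold natZ; destruct (0 <=? k)%Z; [apply Rlt_le, exp_coeff_gt0|lra].
- apply summableZ_natZ; eapply ex_series_ext; [|apply (ex_series_exp_tail N)].
  intros j; symmetry; apply Rabs_pos_eq, Rlt_le, exp_coeff_gt0.
- rewrite sumZ_nat_part by (intros; apply natZ_neg).
  right; apply Series_ext; intros j; exact (natZ_of_nat (fun i => exp_coeff (S N + i)) j).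
- apply exp_tail_gt0.
- intros k; destruct (op_pow_l2 _ _ (S N + Z.to_nat k) Hpsi (Rle_refl _)) as [P1 P2].
  set (b := (t * W) ^ (S N + Z.to_nat k)) in *.
  assert (Hb : 0 < b) by apply HB.
  assert (Hne : RtoC b <> 0%C) by (intros E; apply RtoC_inj in E; lra).
  assert (E : forall n, / b ^ 2 * Cmod (op_pow A (S N + Z.to_nat k) psi n) ^ 2
     = Cmod (f k n) ^ 2).
  { intros n; unfold f; rewrite Cmod_opp, Cmod_div by exact Hne.
    fold b; rewrite Cmod_R, Rabs_pos_eq by lra; field; lra. }
  split; [apply (summableZ_ext _ _ E), summableZ_scal, P1|].
  rewrite <- (sumZ_ext _ _ E), sumZ_scal.
  apply Rle_trans with (/ b ^ 2 * (b ^ 2 * sumZ (fun n => Cmod (psi n) ^ 2))).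
  + apply Rmult_le_compat_l; [|exact P2].
    apply Rlt_le, Rinv_0_lt_compat; nra.
  + right; field; lra.
- assert (E : forall n, Cmod (CsumZ (fun k => natZ (fun j => exp_coeff (S N + j)) k * f k n)%C) ^ 2
     = Cmod (exp_partial A N psi n - exp_sum psi n)%C ^ 2).
  { intros n; unfold f; now rewrite (exp_remainder _ _ N n HM). }
  split; [apply (summableZ_ext _ _ E), H1|].
  rewrite <- (sumZ_ext _ _ E); exact H2.
Qed.

Lemma is_op_exp_exp_sum : is_op_exp A exp_sum.
Proof using All.
intros eps Heps.
destruct (proj2 (is_lim_seq_spec _ _) exp_tail_lim (mkposreal eps Heps)) as [N0 HN0].
exists N0; intros N HN psi Hpsi; specialize (HN0 N HN); simpl in HN0.
rewrite Rminus_0_r, Rabs_pos_eq in HN0 by apply Rlt_le, exp_tail_gt0.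
assert (HT := exp_tail_gt0 N).
destruct (exp_remainder_l2 psi N Hpsi) as [H1 H2].
assert (HP := in_l2_exp_partial psi N Hpsi).
split; [exact HP|split].
(* [exp_sum psi] is the partial sum minus the remainder, both already known to be in l^2. *)
- refine (summableZ_ext _ _ _ (in_l2_minus _ _ HP H1)).
  intros n; do 2 f_equal; unfold Cminus; ring.
- unfold norm2; rewrite <- (sqrt_pow2 eps) by lra.
  rewrite <- sqrt_mult_alt by apply pow2_ge_0.
  apply sqrt_le_1_alt; eapply Rle_trans; [exact H2|].
  apply Rmult_le_compat_r.
  + apply sumZ_ge0; [exact Hpsi|intros; apply pow2_ge_0].
  + apply pow_incr; lra.
Qed.

(** The witness [exp_sum] makes [epsilon] return some exponential, and two l^2 limits of the same
    partial sums agree at each point because a point value is at most the l^2 norm. *)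
Lemma op_exp_eq (psi : Z -> C) (n : Z) : in_l2 psi -> op_exp A psi n = exp_sum psi n.
Proof using All.
intros Hpsi.
assert (HF : is_op_exp A (op_exp A)).
{ unfold op_exp; apply epsilon_spec; exists exp_sum; exact is_op_exp_exp_sum. }
apply Ceq_minus, Cmod_eq_0, Rle_antisym; [|apply Cmod_ge_0].
apply le_epsilon; intros eps Heps; rewrite Rplus_0_l.
assert (Hn : 0 <= norm2 psi) by apply sqrt_pos.
(* Each of the two approximations may cost [eps / 2]; the [+ 1] keeps the denominator positive when
   [psi] vanishes. *)
set (d := eps / (2 * (norm2 psi + 1))).
assert (Hd : 0 < d) by (apply Rdiv_lt_0_compat; lra).
destruct (HF d Hd) as [N1 H1]; destruct (is_op_exp_exp_sum d Hd) as [N2 H2].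
destruct (H1 (N1 + N2)%nat ltac:(lia) psi Hpsi) as (P1 & P2 & P3).
destruct (H2 (N1 + N2)%nat ltac:(lia) psi Hpsi) as (Q1 & Q2 & Q3).
assert (R1 := Rle_trans _ _ _ (Cmod_le_norm2 _ n (in_l2_minus _ _ P1 P2)) P3).
assert (R2 := Rle_trans _ _ _ (Cmod_le_norm2 _ n (in_l2_minus _ _ Q1 Q2)) Q3).
cbv beta in R1, R2; set (p := exp_partial A (N1 + N2) psi n) in *.
replace (op_exp A psi n - exp_sum psi n)%C
  with ((p - exp_sum psi n) + - (p - op_exp A psi n))%C by ring.
eapply Rle_trans; [apply Cmod_triangle|]; rewrite Cmod_opp.
assert (d * norm2 psi <= eps / 2); [|lra].
apply Rle_trans with (d * (norm2 psi + 1)); [nra|].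
right; unfold d; field; lra.
Qed.

End Exponential.

(** * Fourier series of the parabola *)

Lemma is_RInt_unit_bound (f : R -> R) (I M : R) :
  is_RInt f 0 1 I -> (forall x, 0 < x < 1 -> Rabs (f x) <= M) -> Rabs I <= M.
Proof.
intros HI HM.
assert (HP := is_RInt_const (V := R_NormedModule) 0 1 M).
assert (HN := is_RInt_const (V := R_NormedModule) 0 1 (- M)).
change (scal ?a ?b) with (a * b) in HP; change (scal ?a ?b) with (a * b) in HN.
apply Rabs_le; split.
- replace (- M) with ((1 - 0) * - M) by ring.
  apply (is_RInt_le _ _ 0 1 _ _ Rle_0_1 HN HI).
  intros x Hx; specialize (HM x Hx); apply Rabs_le_between in HM; lra.
- replace M with ((1 - 0) * M) by ring.
  apply (is_RInt_le _ _ 0 1 _ _ Rle_0_1 HI HP).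
  intros x Hx; specialize (HM x Hx); apply Rabs_le_between in HM; lra.
Qed.

(** The products of sine and cosine telescope. Since [sum_n] up to [N] reaches frequency [N + 1],
    the kernel has the odd number [2 * N + 3] in place of the usual [2 * N + 1]. *)
Lemma dirichlet_kernel (x : R) (N : nat) :
  sin (PI * x) * (1 + 2 * sum_n (fun l => cos (2 * PI * INR (S l) * x)) N)
  = sin (INR (2 * N + 3) * PI * x).
Proof.
assert (E : forall a b, sin a * (2 * cos b) = sin (b + a) - sin (b - a))
  by (intros; rewrite sin_plus, sin_minus; ring).
induction N as [|N IH].
- rewrite sum_O, Rmult_plus_distr_l, E, Rmult_1_r.
  replace (2 * PI * INR 1 * x - PI * x) with (PI * x) by (simpl; ring).
  replace (2 * PI * INR 1 * x + PI * x) with (INR (2 * 0 + 3) * PI * x) by (simpl; ring).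
  ring.
- rewrite sum_Sn; change plus with Rplus.
  rewrite (Rmult_plus_distr_l 2), <- (Rplus_assoc 1).
  rewrite Rmult_plus_distr_l, IH, E.
  replace (2 * PI * INR (S (S N)) * x - PI * x) with (INR (2 * N + 3) * PI * x)
    by (rewrite plus_INR, mult_INR, !S_INR; simpl; ring).
  replace (2 * PI * INR (S (S N)) * x + PI * x) with (INR (2 * S N + 3) * PI * x)
    by (rewrite plus_INR, mult_INR, !S_INR; simpl; ring).
  ring.
Qed.

(** The coefficient of each cosine is twice the Fourier coefficient, the frequencies [l] and [- l]
    being merged. *)
Definition parabola_partial (N : nat) (x : R) : R :=
  1 / 12 + sum_n (fun l => cos (2 * PI * INR (S l) * x) / (PI ^ 2 * INR (S l) ^ 2)) N.

Definition parabola_error (N : nat) (x : R) : R :=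
  (x - 1 / 2) ^ 2 - parabola_partial N x.

Definition parabola_error' (N : nat) (x : R) : R :=
  2 * (x - 1 / 2) - sum_n (fun l => - (2 * sin (2 * PI * INR (S l) * x) / (PI * INR (S l)))) N.

Lemma INR_S_neq0 (l : nat) : INR (S l) <> 0.
Proof. apply not_0_INR; discriminate. Qed.

Lemma is_derive_parabola_error (N : nat) (x : R) :
  is_derive (parabola_error N) x (parabola_error' N x).
Proof.
unfold parabola_error, parabola_error', parabola_partial.
apply (is_derive_minus (V := R_NormedModule) (fun x => (x - 1 / 2) ^ 2)).
- auto_derive; [trivial|ring].
- evar_last.
  + apply (is_derive_plus (V := R_NormedModule) (fun _ => 1 / 12)).
    * apply is_derive_const.
    * apply (is_derive_sum_n (V := R_NormedModule)
        (fun l x => cos (2 * PI * INR (S l) * x) / (PI ^ 2 * INR (S l) ^ 2)) N x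
        (fun l => - (2 * sin (2 * PI * INR (S l) * x) / (PI * INR (S l))))).
      intros l _; generalize (INR_S_neq0 l) PI_neq0; cbv beta.
      generalize (INR (S l)); intros c H HP.
      auto_derive; [trivial|field; auto].
  + apply plus_zero_l.
Qed.

Lemma sum_n_scal_R (c : R) (a : nat -> R) (N : nat) :
  sum_n (fun l => c * a l) N = c * sum_n a N.
Proof.
induction N as [|N IH]; [now rewrite !sum_O|].
rewrite !sum_Sn, IH; symmetry; apply Rmult_plus_distr_l.
Qed.

(** Two derivatives cancel the quadratic decay of the coefficients and leave twice the Dirichlet
    kernel, which has a closed form. *)
Lemma is_derive_parabola_error' (N : nat) (x : R) : sin (PI * x) <> 0 ->
  is_derive (parabola_error' N) x (2 * sin (INR (2 * N + 3) * PI * x) / sin (PI * x)).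
Proof.
intros Hs; unfold parabola_error'; evar_last.
- apply (is_derive_minus (V := R_NormedModule) (fun x => 2 * (x - 1 / 2))).
  + auto_derive; [trivial|reflexivity].
  + apply (is_derive_sum_n (V := R_NormedModule)
      (fun l x => - (2 * sin (2 * PI * INR (S l) * x) / (PI * INR (S l)))) N x
      (fun l => - 4 * cos (2 * PI * INR (S l) * x))).
    intros l _; generalize (INR_S_neq0 l) PI_neq0; cbv beta.
      generalize (INR (S l)); intros c H HP.
    auto_derive; [trivial|field; auto].
- rewrite <- dirichlet_kernel.
  change (minus ?a ?b) with (a - b); rewrite sum_n_scal_R.
  field; exact Hs.
Qed.

(** The error is symmetric about 1/2, so its derivative vanishes there; 1/2 is therefore the base
    point of the integrations below. *)
Lemma parabola_error'_half (N : nat) : parabola_error' N (1 / 2) = 0.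
Proof.
unfold parabola_error'.
rewrite (sum_n_ext _ (fun _ => 0)).
- rewrite sum_n_const; lra.
- intros l; rewrite sin_eq_0_1; [|exists (Z.of_nat (S l)); rewrite <- INR_IZR_INZ; lra].
  change (- (2 * 0 / (PI * INR (S l))) = 0); unfold Rdiv; ring.
Qed.

Lemma between_bound (f df : R -> R) (a b K : R) :
  (forall x, Rmin a b <= x <= Rmax a b -> is_derive f x (df x) /\ Rabs (df x) <= K) ->
  Rabs (f b - f a) <= K * Rabs (b - a).
Proof.
intros H; destruct (MVT_gen f a b df) as (c & Hc & E).
- intros x Hx; apply H; lra.
- intros x Hx; apply derivable_continuous_pt; exists (df x).
  apply is_derive_Reals, H, Hx.
- rewrite E, Rabs_mult; apply Rmult_le_compat_r; [apply Rabs_pos|apply H, Hc].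
Qed.

(** The sine decreases on moving away from 1/2 in either direction, so on the segment from 1/2 to
    [x] the denominators of the kernel are worst at [x]. *)
Lemma sin_PI_ge_between (x y : R) : 0 < x < 1 ->
  Rmin (1 / 2) x <= y <= Rmax (1 / 2) x -> sin (PI * x) <= sin (PI * y).
Proof.
intros Hx; assert (HP := PI_RGT_0).
unfold Rmin, Rmax; destruct (Rle_dec (1 / 2) x) as [H|H]; intros Hy.
- apply sin_decr_1; nra.
- apply sin_incr_1; nra.
Qed.

Lemma parabola_error'_bound (N : nat) (x y : R) : 0 < x < 1 ->
  Rmin (1 / 2) x <= y <= Rmax (1 / 2) x ->
  Rabs (parabola_error' N y)
    <= (2 * PI / sin (PI * x) ^ 2 + 2 / sin (PI * x)) / (INR (2 * N + 3) * PI).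
Proof.
intros Hx Hy; assert (HP := PI_RGT_0).
set (s := sin (PI * x)); assert (Hs : 0 < s) by (apply sin_gt_0; nra).
set (nu := INR (2 * N + 3) * PI).
assert (Hnu : 0 < nu).
{ apply Rmult_lt_0_compat; [apply lt_0_INR; lia|exact HP]. }
assert (Hsy : forall z, Rmin (1 / 2) x <= z <= Rmax (1 / 2) x -> s <= sin (PI * z))
  by (intros; now apply sin_PI_ge_between).
(* Integration by parts of the Dirichlet kernel: subtracting the boundary term
   leaves a derivative of size [O(1 / N)]. *)
set (g := fun z => parabola_error' N z + 2 * cos (nu * z) / (nu * sin (PI * z))).
set (dg := fun z => - (2 * PI * cos (nu * z) * cos (PI * z)) / (nu * sin (PI * z) ^ 2)).
assert (Hg : Rabs (g y - g (1 / 2)) <= 2 * PI / (nu * s ^ 2) * Rabs (y - 1 / 2)).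
{ apply between_bound with dg; intros z Hz.
  assert (Hz' : s <= sin (PI * z)).
  { apply Hsy; revert Hz Hy; unfold Rmin, Rmax; repeat destruct Rle_dec; lra. }
  split.
  - evar_last.
    + apply (is_derive_plus (V := R_NormedModule) (parabola_error' N)).
      * apply is_derive_parabola_error'; lra.
      * apply (is_derive_ext (fun z => 2 * cos (nu * z) / (nu * sin (PI * z)))); [reflexivity|].
        auto_derive; [nra|reflexivity].
    + unfold dg; change plus with Rplus; fold nu; field; lra.
  - assert (Hd : 0 < nu * s ^ 2) by (apply Rmult_lt_0_compat; [|apply pow_lt]; lra).
    assert (Hd' : nu * s ^ 2 <= nu * sin (PI * z) ^ 2)
      by (apply Rmult_le_compat_l; [lra|]; apply pow_incr; lra).
    unfold dg; unfold Rdiv at 1; rewrite Rabs_mult, Rabs_Ropp.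
    rewrite (Rabs_pos_eq (/ _)).
    + unfold Rdiv; apply Rmult_le_compat.
      * apply Rabs_pos.
      * apply Rlt_le, Rinv_0_lt_compat; lra.
      * rewrite !Rabs_mult, (Rabs_pos_eq 2), (Rabs_pos_eq PI) by lra.
        assert (A1 : Rabs (cos (nu * z)) <= 1) by apply Rabs_le, COS_bound.
        assert (A2 : Rabs (cos (PI * z)) <= 1) by apply Rabs_le, COS_bound.
        assert (A3 := Rabs_pos (cos (nu * z))); assert (A4 := Rabs_pos (cos (PI * z))).
        assert (Rabs (cos (nu * z)) * Rabs (cos (PI * z)) <= 1) by nra; nra.
      * now apply Rinv_le_contravar.
    + apply Rlt_le, Rinv_0_lt_compat; lra. }
(* Here [nu / 2] is [(N + 1) * PI + PI / 2], so the boundary term vanishes at 1/2 as well. *)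
assert (G0 : g (1 / 2) = 0).
{ unfold g; rewrite parabola_error'_half, (cos_eq_0_1 (nu * (1 / 2))).
  - unfold Rdiv; ring.
  - exists (Z.of_nat (N + 1)); unfold nu; rewrite <- INR_IZR_INZ, !plus_INR, mult_INR.
    simpl; field. }
rewrite G0, Rminus_0_r in Hg.
assert (Hy2 : Rabs (y - 1 / 2) <= 1).
{ apply Rabs_le; revert Hy; unfold Rmin, Rmax; destruct Rle_dec; lra. }
assert (Hb : Rabs (2 * cos (nu * y) / (nu * sin (PI * y))) <= 2 / (nu * s)).
{ specialize (Hsy y Hy); unfold Rdiv; rewrite Rabs_mult.
  rewrite (Rabs_pos_eq (/ _)) by (apply Rlt_le, Rinv_0_lt_compat; nra).
  apply Rmult_le_compat; [apply Rabs_pos|apply Rlt_le, Rinv_0_lt_compat; nra| |].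
  - rewrite Rabs_mult, (Rabs_pos_eq 2) by lra.
    assert (A1 : Rabs (cos (nu * y)) <= 1) by apply Rabs_le, COS_bound; lra.
  - apply Rinv_le_contravar; nra. }
replace (parabola_error' N y) with (g y + - (2 * cos (nu * y) / (nu * sin (PI * y))))
  by (unfold g; ring).
eapply Rle_trans; [apply Rabs_triang|]; rewrite Rabs_Ropp.
replace ((2 * PI / s ^ 2 + 2 / s) / nu) with (2 * PI / (nu * s ^ 2) + 2 / (nu * s))
  by (field; lra).
apply Rplus_le_compat; [|exact Hb].
eapply Rle_trans; [exact Hg|].
rewrite <- (Rmult_1_r (2 * PI / (nu * s ^ 2))) at 2.
apply Rmult_le_compat_l; [|exact Hy2].
apply Rlt_le, Rdiv_lt_0_compat; [lra|].
apply Rmult_lt_0_compat; [|apply pow_lt]; lra.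
Qed.

(** The derivative is O(1/N) on the segment from 1/2 to [x]. The constant blows up as [x] approaches
    0 or 1, but pointwise convergence is all that identifying the limit takes. *)
Lemma parabola_error_oscillation (x : R) : 0 < x < 1 ->
  is_lim_seq (fun N => parabola_error N x - parabola_error N (1 / 2)) 0.
Proof.
intros Hx; assert (HP := PI_RGT_0).
set (K := 2 * PI / sin (PI * x) ^ 2 + 2 / sin (PI * x)).
assert (HB : forall N, Rabs (parabola_error N x - parabola_error N (1 / 2))
    <= K / PI * Rabs (x - 1 / 2) * / INR (2 * N + 3)).
{ intros N; eapply Rle_trans.
  - apply between_bound with (df := parabola_error' N) (K := K / (INR (2 * N + 3) * PI)).
    intros y Hy; split; [apply is_derive_parabola_error|].
    now apply parabola_error'_bound.
  - right; field; split; [apply not_0_INR; lia|lra]. }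
apply is_lim_seq_abs_0.
apply (is_lim_seq_le_le (fun _ => 0) _
  (fun N => K / PI * Rabs (x - 1 / 2) * / INR (2 * N + 3))).
- intros N; split; [apply Rabs_pos|apply HB].
- apply is_lim_seq_const.
- replace 0 with (K / PI * Rabs (x - 1 / 2) * 0) by ring.
  apply is_lim_seq_mult'; [apply is_lim_seq_const|].
  apply (is_lim_seq_subseq (fun n => / INR n) 0 (fun N => (2 * N + 3)%nat)).
  + apply eventually_subseq; intros; lia.
  + replace (Finite 0) with (Rbar_inv p_infty) by reflexivity.
    apply is_lim_seq_inv; [apply is_lim_seq_INR|discriminate].
Qed.

Definition parabola_coeff (l : nat) : R := / (PI ^ 2 * INR (S l) ^ 2).

Lemma parabola_coeff_gt0 (l : nat) : 0 < parabola_coeff l.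
Proof.
apply Rinv_0_lt_compat, Rmult_lt_0_compat; apply pow_lt;
 [apply PI_RGT_0|apply lt_0_INR; lia].
Qed.

Lemma ex_series_parabola_coeff : ex_series parabola_coeff.
Proof.
assert (E : forall l, / PI ^ 2 * / (INR (S l) * INR (S l)) = parabola_coeff l).
{ intros l; unfold parabola_coeff; assert (H := INR_S_neq0 l); assert (HP := PI_neq0).
  field; auto. }
apply (ex_series_ext _ _ E).
exact (@ex_series_scal R_AbsRing R_NormedModule _ _ ex_series_inv_sq).
Qed.

Definition parabola_tail (N : nat) : R := Series (fun k => parabola_coeff (S N + k)).

Lemma parabola_tail_lim : is_lim_seq parabola_tail 0.
Proof.
apply is_lim_seq_ext with (fun N => Series parabola_coeff - sum_n parabola_coeff N).
- intros N; unfold parabola_tail.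
  rewrite (Series_incr_n _ (S N) (Nat.lt_0_succ N) ex_series_parabola_coeff).
  simpl Init.Nat.pred; rewrite sum_n_Reals; ring.
- replace 0 with (Series parabola_coeff - Series parabola_coeff) by ring.
  apply is_lim_seq_minus'; [apply is_lim_seq_const|].
  exact (Series_correct _ ex_series_parabola_coeff).
Qed.

(** The parabola minus its full Fourier series. It is shown to be constant on (0,1) by the
    oscillation estimate, and then zero by taking means. *)
Definition parabola_limit (x : R) : R :=
  (x - 1 / 2) ^ 2 - (1 / 12 +
    Series (fun l => cos (2 * PI * INR (S l) * x) / (PI ^ 2 * INR (S l) ^ 2))).

Lemma parabola_term_bound (x : R) (l : nat) :
  Rabs (cos (2 * PI * INR (S l) * x) / (PI ^ 2 * INR (S l) ^ 2)) <= parabola_coeff l.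
Proof.
assert (H := parabola_coeff_gt0 l); unfold Rdiv; fold (parabola_coeff l).
rewrite Rabs_mult, (Rabs_pos_eq (parabola_coeff l)) by lra.
assert (A : Rabs (cos (2 * PI * INR (S l) * x)) <= 1) by apply Rabs_le, COS_bound.
assert (A' := Rabs_pos (cos (2 * PI * INR (S l) * x))); nra.
Qed.

Lemma ex_series_parabola (x : R) :
  ex_series (fun l => Rabs (cos (2 * PI * INR (S l) * x) / (PI ^ 2 * INR (S l) ^ 2))).
Proof.
refine (@ex_series_le R_AbsRing R_CompleteNormedModule _ _ _ ex_series_parabola_coeff).
intros l; change (norm ?y) with (Rabs y); rewrite Rabs_Rabsolu; apply parabola_term_bound.
Qed.

Lemma parabola_error_limit (N : nat) (x : R) :
  Rabs (parabola_error N x - parabola_limit x) <= parabola_tail N.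
Proof.
unfold parabola_error, parabola_limit, parabola_partial.
set (a := fun l => cos (2 * PI * INR (S l) * x) / (PI ^ 2 * INR (S l) ^ 2)).
assert (Ha : ex_series a) by apply ex_series_Rabs, ex_series_parabola.
rewrite (Series_incr_n a (S N) (Nat.lt_0_succ N) Ha); simpl Init.Nat.pred.
rewrite <- sum_n_Reals.
replace (_ - _) with (Series (fun k => a (S N + k)%nat)) by ring.
assert (Ht : ex_series (fun k => parabola_coeff (S N + k)))
  by (apply (@ex_series_incr_n R_AbsRing R_NormedModule parabola_coeff),
      ex_series_parabola_coeff).
eapply Rle_trans; [apply Series_Rabs|].
- apply (@ex_series_incr_n R_AbsRing R_NormedModule (fun k => Rabs (a k))).
  apply ex_series_parabola.
- apply Series_le; [|exact Ht].
  intros k; split; [apply Rabs_pos|apply parabola_term_bound].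
Qed.

Lemma is_lim_seq_unif (u t : nat -> R) (l : R) :
  (forall N, Rabs (u N - l) <= t N) -> is_lim_seq t 0 -> is_lim_seq u l.
Proof.
intros H Ht.
assert (L : is_lim_seq (fun N => (u N - l) + l) (0 + l)).
{ apply is_lim_seq_plus'; [|apply is_lim_seq_const].
  apply is_lim_seq_abs_0, (is_lim_seq_le_le (fun _ => 0) _ t); auto.
  - intros N; split; [apply Rabs_pos|apply H].
  - apply is_lim_seq_const. }
rewrite Rplus_0_l in L; revert L; apply is_lim_seq_ext; intros N; ring.
Qed.

Lemma parabola_limit_const (x : R) : 0 < x < 1 -> parabola_limit x = parabola_limit (1 / 2).
Proof.
intros Hx.
assert (L : forall y, is_lim_seq (fun N => parabola_error N y) (parabola_limit y)).
{ intros y; apply is_lim_seq_unif with parabola_tail; [|apply parabola_tail_lim].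
  intros N; apply parabola_error_limit. }
assert (H1 := parabola_error_oscillation x Hx).
assert (H2 := is_lim_seq_minus' _ _ _ _ (L x) (L (1 / 2))).
apply is_lim_seq_unique in H1; apply is_lim_seq_unique in H2.
rewrite H1 in H2; injection H2; lra.
Qed.

Lemma is_RInt_parabola_error (N : nat) : is_RInt (parabola_error N) 0 1 0.
Proof.
assert (HP := PI_neq0).
set (F := fun x => ((x - 1 / 2) ^ 3 / 3 - x / 12) -
  sum_n (fun l => sin (2 * PI * INR (S l) * x) / (2 * PI ^ 3 * INR (S l) ^ 3)) N).
assert (HF : forall x k, (x = IZR k) ->
  F x = (x - 1 / 2) ^ 3 / 3 - x / 12).
{ intros x k Hx; unfold F; rewrite (sum_n_ext _ (fun _ => 0)).
  - rewrite sum_n_const; ring.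
  - intros l; rewrite sin_eq_0_1; [apply Rmult_0_l|].
    exists (2 * Z.of_nat (S l) * k)%Z; rewrite !mult_IZR, <- INR_IZR_INZ, Hx; ring. }
evar_last.
- apply (is_RInt_derive (V := R_CompleteNormedModule) F (parabola_error N)).
  + intros x _; unfold parabola_error, parabola_partial.
    evar_last.
    * apply (is_derive_minus (V := R_NormedModule) (fun x => (x - 1 / 2) ^ 3 / 3 - x / 12)
        _ x ((x - 1 / 2) ^ 2 - 1 / 12)).
      { auto_derive; [trivial|field]. }
      apply (is_derive_sum_n (V := R_NormedModule)
        (fun l x => sin (2 * PI * INR (S l) * x) / (2 * PI ^ 3 * INR (S l) ^ 3)) N x
        (fun l => cos (2 * PI * INR (S l) * x) / (PI ^ 2 * INR (S l) ^ 2))).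
      intros l _; generalize (INR_S_neq0 l); cbv beta.
      generalize (INR (S l)); intros c H.
      auto_derive; [trivial|field; auto].
    * change (minus ?a ?b) with (a - b).
      change (NormedModule.AbelianMonoid R_AbsRing R_NormedModule) with R_AbelianMonoid; ring.
  + intros x _; apply (@ex_derive_continuous R_AbsRing R_NormedModule).
    eexists; apply is_derive_parabola_error.
- change (minus ?a ?b) with (a - b).
  rewrite (HF 1 1%Z), (HF 0 0%Z) by reflexivity; field.
Qed.

(** [parabola_error M] has mean zero and differs from the constant limit by at most
    [parabola_tail M]; integrating bounds that constant by every tail, so it is zero. The resulting
    estimate is uniform in [x]. *)
Lemma parabola_fourier (N : nat) (x : R) : 0 < x < 1 ->
  Rabs (parabola_error N x) <= parabola_tail N.
Proof.
intros Hx.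
assert (H : forall M, Rabs (parabola_limit (1 / 2)) <= parabola_tail M).
{ intros M; rewrite <- Rabs_Ropp.
  apply is_RInt_unit_bound with (fun y => parabola_error M y - parabola_limit (1 / 2)).
  - evar_last.
    + apply (is_RInt_minus (V := R_NormedModule) (parabola_error M)).
      * apply is_RInt_parabola_error.
      * apply is_RInt_const.
    + unfold minus, plus, opp, scal; simpl; unfold mult; simpl; ring.
  - intros y Hy; rewrite <- (parabola_limit_const y Hy); apply parabola_error_limit. }
assert (H0 : parabola_limit (1 / 2) = 0).
{ apply Rabs_eq_0, Rle_antisym; [|apply Rabs_pos].
  apply (is_lim_seq_le (fun _ => Rabs (parabola_limit (1 / 2))) parabola_tail
    (Rabs (parabola_limit (1 / 2))) 0 H); [apply is_lim_seq_const|apply parabola_tail_lim]. }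
rewrite <- (Rminus_0_r (parabola_error N x)), <- H0, <- (parabola_limit_const x Hx).
apply parabola_error_limit.
Qed.

(** * Moments of the parabola and their convolution rule *)

Lemma sumZ_symmetric_lim (f : Z -> R) : summableZ f ->
  is_lim_seq (fun N => f 0%Z +
    sum_n (fun m => f (Z.of_nat (S m)) + f (- Z.of_nat (S m))%Z) N) (sumZ f).
Proof.
intros Hf; destruct (summableZ_ex_series _ Hf) as [H1 H2].
unfold sumZ; rewrite (Series_incr_1 _ H1), Rplus_assoc.
apply (@ex_series_incr_1 R_AbsRing R_NormedModule) in H1.
apply is_lim_seq_plus'; [apply is_lim_seq_const|].
rewrite <- (Series_plus _ _ H1 H2).
exact (Series_correct _ (@ex_series_plus R_AbsRing R_NormedModule _ _ H1 H2)).
Qed.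

(** All Fourier coefficients together: the potential is stored at 0, so the Schrödinger operator
    becomes a single convolution. *)
Definition parabola_weight (l : Z) : R :=
  if Z.eq_dec l 0 then 1 / 12 else 1 / (2 * PI ^ 2 * (IZR l * IZR l)).

(** The Fourier coefficients of the k-th power of the parabola. A cosine suffices because the
    parabola is symmetric about 1/2, which kills the sine part. *)
Definition moment (k : nat) (j : Z) : R :=
  RInt (fun x => ((x - 1 / 2) ^ 2) ^ k * cos (2 * PI * IZR j * x)) 0 1.

Lemma is_RInt_smooth (f : R -> R) (a b : R) :
  (forall x, ex_derive f x) -> is_RInt f a b (RInt f a b).
Proof.
intros H; apply (RInt_correct (V := R_CompleteNormedModule)).
apply (ex_RInt_continuous (V := R_CompleteNormedModule)).
intros x _; apply (@ex_derive_continuous R_AbsRing R_NormedModule), H.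
Qed.

Lemma is_RInt_moment (k : nat) (j : Z) :
  is_RInt (fun x => ((x - 1 / 2) ^ 2) ^ k * cos (2 * PI * IZR j * x)) 0 1 (moment k j).
Proof. apply is_RInt_smooth; intros x; auto_derive; trivial. Qed.

Lemma moment_integrand_bound (k : nat) (j : Z) (x : R) : 0 <= x <= 1 ->
  Rabs (((x - 1 / 2) ^ 2) ^ k * cos (2 * PI * IZR j * x)) <= 1.
Proof.
intros Hx; rewrite Rabs_mult, <- RPow_abs, (Rabs_pos_eq ((x - 1 / 2) ^ 2))
  by apply pow2_ge_0.
assert (A : Rabs (cos (2 * PI * IZR j * x)) <= 1) by apply Rabs_le, COS_bound.
assert (B : ((x - 1 / 2) ^ 2) ^ k <= 1 ^ k) by (apply pow_incr; split; [apply pow2_ge_0|nra]).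
rewrite pow1 in B.
assert (C := Rabs_pos (cos (2 * PI * IZR j * x))).
assert (D : 0 <= ((x - 1 / 2) ^ 2) ^ k) by apply pow_le, pow2_ge_0.
nra.
Qed.

Lemma moment_bound (k : nat) (j : Z) : Rabs (moment k j) <= 1.
Proof.
apply (is_RInt_unit_bound _ _ _ (is_RInt_moment k j)).
intros x Hx; apply moment_integrand_bound; lra.
Qed.

Lemma is_RInt_lin (f g h : R -> R) (a b c d I J : R) :
  is_RInt f a b I -> is_RInt g a b J -> (forall x, h x = c * f x + d * g x) ->
  is_RInt h a b (c * I + d * J).
Proof.
intros HI HJ E.
apply (is_RInt_ext (fun x => c * f x + d * g x)); [intros x _; symmetry; apply E|].
apply (is_RInt_plus (V := R_NormedModule) (fun x => c * f x) (fun x => d * g x));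
 apply (is_RInt_scal (V := R_NormedModule)); assumption.
Qed.

(** The product formula for cosines splits frequency [m] into the moments at [j + m] and [j - m],
    each with half the merged coefficient, that is, with [parabola_weight]. *)
Lemma is_RInt_moment_partial (k : nat) (j : Z) (N : nat) :
  is_RInt (fun x => ((x - 1 / 2) ^ 2) ^ k * cos (2 * PI * IZR j * x) * parabola_partial N x)
    0 1 (parabola_weight 0 * moment k (j + 0) +
      sum_n (fun m => parabola_weight (Z.of_nat (S m)) * moment k (j + Z.of_nat (S m)) +
        parabola_weight (- Z.of_nat (S m)) * moment k (j + - Z.of_nat (S m))) N).
Proof.
assert (HW : forall m, parabola_weight (Z.of_nat (S m)) = parabola_coeff m / 2 /\
                       parabola_weight (- Z.of_nat (S m)) = parabola_coeff m / 2).
{ intros m; assert (H := INR_S_neq0 m); assert (HP := PI_neq0).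
  unfold parabola_weight, parabola_coeff.
  destruct (Z.eq_dec (Z.of_nat (S m)) 0) as [E|_]; [lia|].
  destruct (Z.eq_dec (- Z.of_nat (S m)) 0) as [E|_]; [lia|].
  rewrite opp_IZR, <- INR_IZR_INZ; split; field; auto. }
assert (HT : forall m, is_RInt (fun x => ((x - 1 / 2) ^ 2) ^ k * cos (2 * PI * IZR j * x) *
    (cos (2 * PI * INR (S m) * x) / (PI ^ 2 * INR (S m) ^ 2))) 0 1
    (parabola_weight (Z.of_nat (S m)) * moment k (j + Z.of_nat (S m)) +
        parabola_weight (- Z.of_nat (S m)) * moment k (j + - Z.of_nat (S m)))).
{ intros m; destruct (HW m) as [-> ->].
  apply (is_RInt_lin _ _ _ _ _ _ _ _ _ (is_RInt_moment k (j + Z.of_nat (S m)))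
    (is_RInt_moment k (j + - Z.of_nat (S m)))).
  intros x; rewrite !plus_IZR, opp_IZR, <- INR_IZR_INZ.
  replace (2 * PI * (IZR j + INR (S m)) * x)
    with (2 * PI * IZR j * x + 2 * PI * INR (S m) * x) by ring.
  replace (2 * PI * (IZR j + - INR (S m)) * x)
    with (2 * PI * IZR j * x - 2 * PI * INR (S m) * x) by ring.
  rewrite cos_plus, cos_minus; unfold parabola_coeff.
  field; split; [apply INR_S_neq0|apply PI_neq0]. }
assert (H0 : is_RInt (fun x => ((x - 1 / 2) ^ 2) ^ k * cos (2 * PI * IZR j * x) * (1 / 12)) 0 1
   (parabola_weight 0 * moment k (j + 0))).
{ rewrite Z.add_0_r.
  change (parabola_weight 0) with (1 / 12).
  replace (1 / 12 * moment k j) with (1 / 12 * moment k j + 0 * moment k j) by ring.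
  apply (is_RInt_lin _ _ _ _ _ _ _ _ _ (is_RInt_moment k j) (is_RInt_moment k j)).
  intros x; ring. }
induction N as [|N IH].
- rewrite sum_O.
  match goal with |- is_RInt _ _ _ (?a + ?b) =>
    replace (a + b) with (1 * a + 1 * b) by ring end.
  apply (is_RInt_lin _ _ _ _ _ _ _ _ _ H0 (HT 0%nat)).
  intros x; unfold parabola_partial; rewrite sum_O; ring.
- rewrite sum_Sn; change plus with Rplus; rewrite <- Rplus_assoc.
  match goal with |- is_RInt _ _ _ (?a + ?b) =>
    replace (a + b) with (1 * a + 1 * b) by ring end.
  apply (is_RInt_lin _ _ _ _ _ _ _ _ _ IH (HT (S N))).
  intros x; unfold parabola_partial; rewrite sum_Sn; change plus with Rplus; ring.
Qed.

Lemma parabola_weight_ge0 (l : Z) : 0 <= parabola_weight l.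
Proof.
unfold parabola_weight; destruct (Z.eq_dec l 0) as [_|H]; [lra|].
assert (H1 := IZR_sqr_ge1 H); assert (0 < PI ^ 2) by apply pow_lt, PI_RGT_0.
apply Rlt_le, Rdiv_lt_0_compat; nra.
Qed.

Lemma summableZ_parabola_weight : summableZ parabola_weight.
Proof.
apply summableZ_inv_sq with (1 / (2 * PI ^ 2)).
intros l Hl; rewrite Rabs_pos_eq by apply parabola_weight_ge0.
unfold parabola_weight; destruct (Z.eq_dec l 0) as [|_]; [contradiction|].
assert (H : IZR l <> 0) by (intro E; apply Hl, eq_IZR, E).
right; field; split; [exact H|apply PI_neq0].
Qed.

(** The Fourier series of one factor of the parabola is integrated term by term: the rest of the
    integrand is at most 1 in modulus, so the error after [N] terms is at most [parabola_tail N]. *)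
Lemma moment_convolution (k : nat) (j : Z) :
  sumZ (fun l => parabola_weight l * moment k (j + l)) = moment (S k) j.
Proof.
set (f := fun l => parabola_weight l * moment k (j + l)).
assert (Hf : summableZ f).
{ apply summableZ_mult_bounded with 1; [apply summableZ_parabola_weight|].
  intros l; apply moment_bound. }
assert (H1 := sumZ_symmetric_lim f Hf).
assert (H2 : is_lim_seq (fun N => f 0%Z +
    sum_n (fun m => f (Z.of_nat (S m)) + f (- Z.of_nat (S m))%Z) N) (moment (S k) j)).
{ apply is_lim_seq_unif with parabola_tail; [|apply parabola_tail_lim].
  intros N; rewrite Rabs_minus_sym.
  apply (is_RInt_unit_bound _ _ _ (is_RInt_minus (V := R_NormedModule) _ _ _ _ _ _
    (is_RInt_moment (S k) j) (is_RInt_moment_partial k j N))).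
  intros x Hx; change (minus ?a ?b) with (a - b).
  replace (_ - _) with (((x - 1 / 2) ^ 2) ^ k * cos (2 * PI * IZR j * x) * parabola_error N x)
    by (unfold parabola_error; simpl; ring).
  rewrite Rabs_mult, <- (Rmult_1_l (parabola_tail N)).
  apply Rmult_le_compat; auto using Rabs_pos, parabola_fourier.
  apply moment_integrand_bound; lra. }
apply is_lim_seq_unique in H1; apply is_lim_seq_unique in H2.
rewrite H1 in H2; now injection H2.
Qed.

(** * Fresnel integrals *)

Definition fresnel (t c a b : R) : R := RInt (fun u => cos (t * u ^ 2 + c)) a b.

Lemma is_RInt_fresnel (t c a b : R) :
  is_RInt (fun u => cos (t * u ^ 2 + c)) a b (fresnel t c a b).
Proof. apply is_RInt_smooth; intros x; auto_derive; trivial. Qed.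

Lemma fresnel_Chasles (t c x y z : R) :
  fresnel t c x z = fresnel t c x y + fresnel t c y z.
Proof.
apply is_RInt_unique, (is_RInt_Chasles (V := R_NormedModule) _ _ y);
 apply is_RInt_fresnel.
Qed.

Lemma fresnel_swap (t c x y : R) : fresnel t c y x = - fresnel t c x y.
Proof.
apply is_RInt_unique, (is_RInt_swap (V := R_NormedModule)), is_RInt_fresnel.
Qed.

Lemma fresnel_even (t c x y : R) : fresnel t c (- x) (- y) = - fresnel t c x y.
Proof.
apply is_RInt_unique.
replace (- fresnel t c x y) with (-1 * fresnel t c x y + 0 * fresnel t c x y) by ring.
assert (H : is_RInt (fun u => - cos (t * (- u) ^ 2 + c)) (- x) (- y) (fresnel t c x y)).
{ apply (is_RInt_comp_opp (V := R_NormedModule) (fun u => cos (t * u ^ 2 + c))).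
  rewrite !Ropp_involutive; apply is_RInt_fresnel. }
apply (is_RInt_lin _ _ _ _ _ _ _ _ _ H H).
intros u; replace ((- u) ^ 2) with (u ^ 2) by ring; ring.
Qed.

Lemma fresnel_tail_upper (t c a b : R) : 0 < t -> 0 < a <= b ->
  fresnel t c a b <= / (t * a).
Proof.
intros Ht Hab.
(* [F'] is the integrand plus the nonnegative [(1 - sin) / (2 t u^2)]. *)
set (F := fun u => (sin (t * u ^ 2 + c) - 1) / (2 * t * u)).
set (dF := fun u => cos (t * u ^ 2 + c) + (1 - sin (t * u ^ 2 + c)) / (2 * t * u ^ 2)).
assert (HF : is_RInt dF a b (F b - F a)).
{ apply (is_RInt_derive (V := R_CompleteNormedModule) F dF);
   intros u; rewrite Rmin_left, Rmax_right by lra; intros Hu;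
   assert (0 < 2 * t * u) by (apply Rmult_lt_0_compat; lra).
  - unfold F, dF; auto_derive; [lra|].
    change (u * (u * 1)) with (u ^ 2); field; lra.
  - apply (@ex_derive_continuous R_AbsRing R_NormedModule).
    assert (0 < 2 * t * u ^ 2) by (apply Rmult_lt_0_compat; [|apply pow_lt]; lra).
    unfold dF; auto_derive; simpl in *; lra. }
apply Rle_trans with (F b - F a).
- apply (is_RInt_le _ _ a b _ _ (proj2 Hab) (is_RInt_fresnel t c a b) HF).
  intros u Hu; unfold dF; assert (B := SIN_bound (t * u ^ 2 + c)).
  assert (0 < 2 * t * u ^ 2) by (apply Rmult_lt_0_compat; [|apply pow_lt]; lra).
  assert (0 <= (1 - sin (t * u ^ 2 + c)) / (2 * t * u ^ 2)); [|lra].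
  apply Rmult_le_pos; [lra|]; apply Rlt_le, Rinv_0_lt_compat; assumption.
(* Subtracting 1 in [F] puts its numerator between -2 and 0: the endpoint [b] contributes nothing
   positive and [a] contributes at most [2 / (2 * t * a)]. *)
- assert (Hb : F b <= 0).
  { assert (0 < 2 * t * b) by (apply Rmult_lt_0_compat; lra).
    unfold F; assert (B := SIN_bound (t * b ^ 2 + c)).
    apply Rle_div_l; lra. }
  assert (Ha : - F a <= / (t * a)).
  { assert (0 < 2 * t * a) by (apply Rmult_lt_0_compat; lra).
    unfold F; assert (B := SIN_bound (t * a ^ 2 + c)).
    replace (/ (t * a)) with (2 / (2 * t * a)) by (field; lra).
    unfold Rdiv; rewrite <- Ropp_mult_distr_l_reverse.
    apply Rmult_le_compat_r; [apply Rlt_le, Rinv_0_lt_compat|]; lra. }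
  lra.
Qed.

(** Since the upper bound holds for every phase, applying it to the phase [c + PI] gives the lower
    bound. *)
Lemma fresnel_shift_PI (t c a b : R) : fresnel t (c + PI) a b = - fresnel t c a b.
Proof.
apply is_RInt_unique.
replace (- fresnel t c a b) with (-1 * fresnel t c a b + 0 * fresnel t c a b) by ring.
apply (is_RInt_lin _ _ _ _ _ _ _ _ _ (is_RInt_fresnel t c a b) (is_RInt_fresnel t c a b)).
intros u; rewrite <- Rplus_assoc, neg_cos; ring.
Qed.

Lemma fresnel_tail (t c a b : R) : 0 < t -> 0 < a <= b ->
  Rabs (fresnel t c a b) <= / (t * a).
Proof.
intros Ht Hab; apply Rabs_le.
assert (H1 := fresnel_tail_upper t c a b Ht Hab).
assert (H2 := fresnel_tail_upper t (c + PI) a b Ht Hab).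
rewrite fresnel_shift_PI in H2; lra.
Qed.

Lemma fresnel_trivial (t c a b : R) : Rabs (fresnel t c a b) <= Rabs (b - a).
Proof.
rewrite <- (Rmult_1_r (Rabs (b - a))).
apply (norm_RInt_le_const_abs (V := R_NormedModule) (fun u => cos (t * u ^ 2 + c)) a b).
- intros x _; apply Rabs_le, COS_bound.
- apply is_RInt_fresnel.
Qed.

(** With [d = / sqrt t] the tail bound [/ (t * d)] equals [d]. Projecting both endpoints onto the
    window by [clamp] treats all their positions at once: at most [d] from each endpoint to its
    projection, and at most [2 * d] between the projections. *)
Lemma fresnel_bound (t c a b : R) : 0 < t -> Rabs (fresnel t c a b) <= 4 * / sqrt t.
Proof.
intros Ht; assert (Hs : 0 < sqrt t) by now apply sqrt_lt_R0.
set (d := / sqrt t); assert (Hd : 0 < d) by now apply Rinv_0_lt_compat.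
assert (Htd : / (t * d) = d).
{ unfold d; rewrite <- (sqrt_sqrt t) at 1 by lra; field; lra. }
set (clamp := fun x => Rmax (- d) (Rmin d x)).
assert (HC : forall x, - d <= clamp x <= d).
{ intros x; unfold clamp, Rmax, Rmin; repeat destruct Rle_dec; lra. }
assert (HP : forall x, Rabs (fresnel t c x (clamp x)) <= d).
{ intros x; destruct (Rle_dec d x) as [H1|H1]; [|destruct (Rle_dec x (- d)) as [H2|H2]].
  - replace (clamp x) with d
      by (unfold clamp, Rmax, Rmin; repeat destruct Rle_dec; lra).
    rewrite fresnel_swap, Rabs_Ropp.
    eapply Rle_trans; [apply fresnel_tail; lra|lra].
  - replace (clamp x) with (- d)
      by (unfold clamp, Rmax, Rmin; repeat destruct Rle_dec; lra).
    rewrite <- (Ropp_involutive x), fresnel_even, fresnel_swap, Ropp_involutive.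
    eapply Rle_trans; [apply fresnel_tail; lra|lra].
  - replace (clamp x) with x
      by (unfold clamp, Rmax, Rmin; repeat destruct Rle_dec; lra).
    eapply Rle_trans; [apply fresnel_trivial|].
    rewrite Rminus_diag, Rabs_R0; lra. }
assert (HM : Rabs (fresnel t c (clamp a) (clamp b)) <= 2 * d).
{ eapply Rle_trans; [apply fresnel_trivial|].
  assert (Ha := HC a); assert (Hb := HC b); apply Rabs_le; lra. }
rewrite (fresnel_Chasles t c a (clamp a) b), (fresnel_Chasles t c (clamp a) (clamp b) b).
rewrite (fresnel_swap t c b (clamp b)).
assert (Pa := HP a); assert (Pb := HP b).
apply Rabs_le; apply Rabs_le_between in Pa; apply Rabs_le_between in Pb;
 apply Rabs_le_between in HM; lra.
Qed.

Lemma parabola_phase_integral (t c j : R) : 0 < t ->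
  is_RInt (fun x => cos (t * (x - 1 / 2) ^ 2 + 2 * PI * j * x + c)) 0 1
    (fresnel t (c + PI * j - (PI * j) ^ 2 / t) (PI * j / t - 1 / 2) (PI * j / t + 1 / 2)).
Proof.
intros Ht; set (v := PI * j / t - 1 / 2); set (c' := c + PI * j - (PI * j) ^ 2 / t).
assert (H := is_RInt_comp_lin (V := R_NormedModule) (fun u => cos (t * u ^ 2 + c'))
  1 v 0 1 (fresnel t c' (1 * 0 + v) (1 * 1 + v)) (is_RInt_fresnel _ _ _ _)).
replace (1 * 0 + v) with v in H by ring.
replace (1 * 1 + v) with (PI * j / t + 1 / 2) in H by (unfold v; field; lra).
revert H; apply is_RInt_ext; intros x _.
change (1 * cos (t * (1 * x + v) ^ 2 + c') = cos (t * (x - 1 / 2) ^ 2 + 2 * PI * j * x + c)).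
rewrite Rmult_1_l; f_equal; unfold v, c'; field; lra.
Qed.

(** The phases 0 and [- PI / 2] give the real and imaginary parts of the propagator kernel, so one
    real family covers both. *)
Definition oscillatory (t phi : R) (j : Z) : R :=
  RInt (fun x => cos (t * (x - 1 / 2) ^ 2 + phi) * cos (2 * PI * IZR j * x)) 0 1.

Lemma is_RInt_oscillatory (t phi : R) (j : Z) :
  is_RInt (fun x => cos (t * (x - 1 / 2) ^ 2 + phi) * cos (2 * PI * IZR j * x)) 0 1
    (oscillatory t phi j).
Proof. apply is_RInt_smooth; intros x; auto_derive; trivial. Qed.

Lemma oscillatory_bound (t phi : R) (j : Z) : 0 < t ->
  Rabs (oscillatory t phi j) <= 4 * / sqrt t.
Proof.
intros Ht.
assert (HE : forall x, cos (t * (x - 1 / 2) ^ 2 + phi) * cos (2 * PI * IZR j * x) =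
  1 / 2 * cos (t * (x - 1 / 2) ^ 2 + 2 * PI * IZR j * x + phi) +
  1 / 2 * cos (t * (x - 1 / 2) ^ 2 + 2 * PI * - IZR j * x + phi)).
{ intros x; set (a := t * (x - 1 / 2) ^ 2 + phi); set (b := 2 * PI * IZR j * x).
  replace (_ + b + phi) with (a + b) by (unfold a; ring).
  replace (_ + 2 * PI * - IZR j * x + phi) with (a - b) by (unfold a, b; ring).
  rewrite cos_plus, cos_minus; field. }
assert (E := is_RInt_unique _ _ _ _ (is_RInt_lin _ _ _ _ _ _ _ _ _
  (parabola_phase_integral t phi (IZR j) Ht)
  (parabola_phase_integral t phi (- IZR j) Ht) HE)).
unfold oscillatory; rewrite E.
match goal with |- Rabs (_ * fresnel ?t1 ?c1 ?a1 ?b1 + _ * fresnel ?t2 ?c2 ?a2 ?b2) <= _ =>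
  assert (B1 := fresnel_bound t1 c1 a1 b1 Ht);
  assert (B2 := fresnel_bound t2 c2 a2 b2 Ht) end.
apply Rabs_le; apply Rabs_le_between in B1; apply Rabs_le_between in B2; lra.
Qed.

Lemma cos_ge_quadratic (x : R) : 1 - x ^ 2 / 2 <= cos x.
Proof.
assert (H : Rabs (sin (x / 2) - sin 0) <= 1 * Rabs (x / 2 - 0)).
{ apply between_bound with cos; intros y _; split.
  - auto_derive; [trivial|ring].
  - apply Rabs_le, COS_bound. }
rewrite sin_0, !Rminus_0_r, Rmult_1_l in H.
apply Rsqr_le_abs_1 in H; unfold Rsqr in H.
replace x with (2 * (x / 2)) at 2 by field; rewrite cos_2a_sin; nra.
Qed.

Lemma oscillatory_lower (t : R) : 25 / 4 <= t -> / 4 * / sqrt t <= oscillatory t 0 0.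
Proof.
intros Ht; assert (Hs : 0 < sqrt t) by (apply sqrt_lt_R0; lra).
assert (Hs' : 5 / 2 <= sqrt t).
{ rewrite <- (sqrt_square (5 / 2)) by lra; apply sqrt_le_1_alt; lra. }
assert (Hst : sqrt t * sqrt t = t) by (apply sqrt_sqrt; lra).
set (d := / sqrt t); assert (Hd : 0 < d) by now apply Rinv_0_lt_compat.
assert (Hds : d * sqrt t = 1) by (unfold d; field; lra).
(* The window of half-width [d] is too small: it would leave [d - d / 10 - d < 0]. With 5/4 one gets
   5/4 - 3125/10240 - 4/5 > 1/8, and doubling by evenness exceeds 1/4. The condition [25 / 4 <= t]
   ensures [b <= 1 / 2]. *)
set (b := 5 / 4 * d).
assert (Hb : 0 < b <= 1 / 2) by (unfold b; nra).
assert (H1 : b - t ^ 2 * b ^ 5 / 10 <= fresnel t 0 0 b).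
{ set (F := fun u => u - t ^ 2 * u ^ 5 / 10).
  set (dF := fun u => 1 - (t * u ^ 2 + 0) ^ 2 / 2).
  replace (b - t ^ 2 * b ^ 5 / 10) with (F b - F 0) by (unfold F; field).
  apply (is_RInt_le dF (fun u => cos (t * u ^ 2 + 0)) 0 b); [lra| |apply is_RInt_fresnel|].
  - apply (is_RInt_derive (V := R_CompleteNormedModule) F dF); intros u _.
    + unfold F, dF; auto_derive; [trivial|field].
    + apply (@ex_derive_continuous R_AbsRing R_NormedModule); unfold dF; auto_derive; trivial.
  - intros u _; apply cos_ge_quadratic. }
assert (H2 : - / (t * b) <= fresnel t 0 b (1 / 2)).
{ assert (H := fresnel_tail t 0 b (1 / 2) ltac:(lra) Hb).
  apply Rabs_le_between in H; lra. }
assert (Etb : / (t * b) = 4 / 5 * d).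
{ unfold b, d; rewrite <- Hst at 1; field; lra. }
assert (E5 : t ^ 2 * b ^ 5 / 10 = 3125 / 10240 * d).
{ unfold b, d; rewrite <- Hst at 1; field; lra. }
assert (E : oscillatory t 0 0 = 2 * fresnel t 0 0 (1 / 2)).
{ assert (H := is_RInt_lin _ _ (fun x => cos (t * (x - 1 / 2) ^ 2 + 0) *
    cos (2 * PI * IZR 0 * x)) _ _ 1 0 _ _ (parabola_phase_integral t 0 0 ltac:(lra))
    (parabola_phase_integral t 0 0 ltac:(lra))).
  unfold oscillatory; erewrite is_RInt_unique; [|apply H].
  - replace (0 + PI * 0 - (PI * 0) ^ 2 / t) with 0 by (field; lra).
    replace (PI * 0 / t - 1 / 2) with (- (1 / 2)) by (field; lra).
    replace (PI * 0 / t + 1 / 2) with (1 / 2) by (field; lra).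
    rewrite (fresnel_Chasles _ _ _ (- 0)), fresnel_even, fresnel_swap.
    rewrite Ropp_0; ring.
  - intros x; cbv beta; replace (2 * PI * 0 * x) with 0 by ring;
    rewrite cos_0, Rplus_0_r, !Rmult_1_r.
    rewrite Rmult_1_l, Rmult_0_l, !Rplus_0_r; reflexivity. }
assert (Eb : b = 5 / 4 * d) by reflexivity.
rewrite Etb in H2; rewrite E5 in H1.
rewrite E, (fresnel_Chasles t 0 0 b (1 / 2)); lra.
Qed.

(** * The propagator on point masses *)

Lemma is_derive_n_cos_shift (phi : R) (k : nat) (x : R) :
  is_derive_n (fun y => cos (y + phi)) k x (cos (x + phi + INR k * (PI / 2))).
Proof.
revert x; induction k as [|k IH]; intros x.
- simpl; f_equal; ring.
- change (is_derive (Derive_n (fun y => cos (y + phi)) k) x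
    (cos (x + phi + INR (S k) * (PI / 2)))).
  apply (is_derive_ext (fun y => cos (y + phi + INR k * (PI / 2)))).
  + intros y; symmetry; apply is_derive_n_unique, IH.
  + replace (cos _) with (- sin (x + phi + INR k * (PI / 2))).
    * auto_derive; [trivial|ring].
    * rewrite S_INR, Rmult_plus_distr_r, Rmult_1_l, <- Rplus_assoc.
      rewrite (cos_plus _ (PI / 2)), cos_PI2, sin_PI2; ring.
Qed.

(** The Taylor polynomial at 0 of the cosine shifted by [phi], with derivatives written as quarter
    turns so that they match the real and imaginary parts of the powers of i. *)
Definition cos_taylor (phi x : R) (N : nat) : R :=
  sum_n (fun k => cos (phi + INR k * (PI / 2)) * x ^ k / INR (fact k)) N.

Lemma cos_taylor_0 (phi : R) (N : nat) : cos_taylor phi 0 N = cos phi.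
Proof.
unfold cos_taylor; induction N as [|N IH].
- rewrite sum_O; simpl; rewrite Rmult_0_l, Rplus_0_r; field.
- rewrite sum_Sn, IH; change plus with Rplus; rewrite pow_ne_zero by discriminate.
  field; apply INR_fact_neq_0.
Qed.

Lemma cos_taylor_bound (phi x : R) (N : nat) : 0 <= x ->
  Rabs (cos (x + phi) - cos_taylor phi x N) <= x ^ S N / INR (fact (S N)).
Proof.
(* [Taylor_Lagrange] is about a nondegenerate interval; the case [x = 0] occurs at the vertex of the
   parabola. *)
intros [Hx|<-].
- destruct (Taylor_Lagrange (fun y => cos (y + phi)) N 0 x Hx) as (z & _ & E).
  { intros y _ [|k] _; [exact I|]; eexists; apply (is_derive_n_cos_shift phi (S k)). }
  rewrite E; unfold cos_taylor; rewrite sum_n_Reals.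
  replace (sum_f_R0 _ N) with
    (sum_f_R0 (fun k => cos (phi + INR k * (PI / 2)) * x ^ k / INR (fact k)) N).
  + rewrite (is_derive_n_unique _ _ _ _ (is_derive_n_cos_shift phi (S N) z)), Rminus_0_r.
    match goal with |- Rabs (?s + ?a * ?b - ?s) <= _ =>
      replace (s + a * b - s) with (a * b) by ring end.
    assert (0 <= x ^ S N / INR (fact (S N))).
    { apply Rlt_le, Rdiv_lt_0_compat; [now apply pow_lt|apply INR_fact_lt_0]. }
    rewrite Rabs_mult, Rabs_pos_eq by assumption.
    rewrite <- (Rmult_1_r (x ^ S N / _)) at 2; apply Rmult_le_compat_l; [assumption|].
    apply Rabs_le, COS_bound.
  + apply sum_eq; intros k _.
    rewrite (is_derive_n_unique _ _ _ _ (is_derive_n_cos_shift phi k 0)).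
    rewrite Rminus_0_r, Rplus_0_l; field; apply INR_fact_neq_0.
- rewrite cos_taylor_0, Rplus_0_l, Rminus_diag, Rabs_R0, pow_ne_zero by discriminate.
  unfold Rdiv; lra.
Qed.

Lemma is_RInt_taylor_moment (t phi : R) (j : Z) (N : nat) :
  is_RInt (fun x => cos_taylor phi (t * (x - 1 / 2) ^ 2) N * cos (2 * PI * IZR j * x)) 0 1
   (sum_n (fun k => cos (phi + INR k * (PI / 2)) * (t ^ k * moment k j) / INR (fact k)) N).
Proof.
unfold cos_taylor; induction N as [|N IH].
- rewrite sum_O.
  replace (cos _ * _ / _) with
    (cos (phi + INR 0 * (PI / 2)) * t ^ 0 / INR (fact 0) * moment 0 j + 0 * moment 0 j)
    by (simpl; field).
  apply (is_RInt_lin _ _ _ _ _ _ _ _ _ (is_RInt_moment 0 j) (is_RInt_moment 0 j)).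
  intros x; rewrite sum_O; simpl; field.
- rewrite sum_Sn; change plus with Rplus.
  assert (Hf := INR_fact_neq_0 (S N)).
  match goal with |- is_RInt _ _ _ (?a + _) => replace (a + _) with
    (1 * a + cos (phi + INR (S N) * (PI / 2)) * t ^ S N / INR (fact (S N)) * moment (S N) j)
    by (field; exact Hf) end.
  apply (is_RInt_lin _ _ _ _ _ _ _ _ _ IH (is_RInt_moment (S N) j)).
  intros x; rewrite sum_Sn; change plus with Rplus; rewrite Rpow_mult_distr.
  field; exact Hf.
Qed.

(** Expanding in powers of [t] under the integral produces the moments. The parabola lies between 0
    and 1 on the unit interval, so the Taylor remainder is at most [t ^ S N] over the factorial of
    [S N], uniformly in [x]. *)
Lemma is_series_oscillatory (t phi : R) (j : Z) : 0 < t ->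
  is_series (fun k => cos (phi + INR k * (PI / 2)) * (t ^ k * moment k j) / INR (fact k))
    (oscillatory t phi j).
Proof.
intros Ht.
apply (is_lim_seq_unif _ (fun N => t ^ S N / INR (fact (S N))) (oscillatory t phi j)).
- intros N; rewrite Rabs_minus_sym.
  apply (is_RInt_unit_bound _ _ _ (is_RInt_minus (V := R_NormedModule) _ _ _ _ _ _
    (is_RInt_oscillatory t phi j) (is_RInt_taylor_moment t phi j N))).
  intros x Hx; change (minus ?a ?b) with (a - b).
  rewrite <- Rmult_minus_distr_r, Rabs_mult.
  assert (H0 : 0 <= t * (x - 1 / 2) ^ 2) by (apply Rmult_le_pos; [lra|apply pow2_ge_0]).
  assert (H1 : (x - 1 / 2) ^ 2 <= 1) by nra.
  assert (B := cos_taylor_bound phi (t * (x - 1 / 2) ^ 2) N H0).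
  assert (Hc : Rabs (cos (2 * PI * IZR j * x)) <= 1) by apply Rabs_le, COS_bound.
  rewrite <- (Rmult_1_r (t ^ S N / _)).
  apply Rmult_le_compat; auto using Rabs_pos.
  eapply Rle_trans; [exact B|].
  apply Rmult_le_compat_r; [apply Rlt_le, Rinv_0_lt_compat, INR_fact_lt_0|].
  apply pow_incr; split; [exact H0|]; nra.
- apply (is_lim_seq_incr_1 (fun N => t ^ N / INR (fact N))).
  apply is_lim_seq_Reals, cv_speed_pow_fact.
Qed.

Definition delta (m n : Z) : C := if Z.eq_dec n m then 1%C else 0%C.

Lemma sumZ_point (f : Z -> R) : (forall k, k <> 0%Z -> f k = 0) ->
  summableZ f /\ sumZ f = f 0%Z.
Proof.
intros H.
assert (Hs : summableZ f)
  by (apply summableZ_inv_sq with 0; intros k Hk; rewrite H, Rabs_R0 by exact Hk; lra).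
split; [exact Hs|].
assert (L := sumZ_symmetric_lim f Hs).
apply is_lim_seq_unique in L.
rewrite (Lim_seq_ext _ (fun _ => f 0%Z)) in L.
- rewrite Lim_seq_const in L; now injection L.
- intros N; rewrite (sum_n_ext _ (fun _ => 0)).
  + rewrite sum_n_const; ring.
  + intros k; rewrite !H by lia; apply Rplus_0_l.
Qed.

Lemma sumZ_delta (m : Z) (f : R -> R) : f 0 = 0 ->
  summableZ (fun n => f (Cmod (delta m n))) /\ sumZ (fun n => f (Cmod (delta m n))) = f 1.
Proof.
intros Hf; destruct (sumZ_point (fun k => f (Cmod (delta 0 k)))) as [H1 H2].
{ intros k Hk; unfold delta; destruct (Z.eq_dec k 0) as [|_]; [contradiction|].
  now rewrite Cmod_0. }
destruct (sumZ_shift _ (- m) H1) as [H3 H4].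
assert (E : forall k, f (Cmod (delta 0 (k + - m))) = f (Cmod (delta m k))).
{ intros k; unfold delta; destruct (Z.eq_dec (k + - m) 0), (Z.eq_dec k m);
   reflexivity || lia. }
split; [exact (summableZ_ext _ _ E H3)|].
rewrite <- (sumZ_ext _ _ E), H4, H2; unfold delta; simpl; now rewrite Cmod_1.
Qed.

Lemma delta_bounded (m : Z) : bounded_by 1 (delta m).
Proof.
intros n; unfold delta; destruct (Z.eq_dec n m); rewrite ?Cmod_1, ?Cmod_0; lra.
Qed.

Lemma moment_0 (j : Z) : moment 0 j = if Z.eq_dec j 0 then 1 else 0.
Proof.
apply is_RInt_unique; destruct (Z.eq_dec j 0) as [->|Hj].
- apply (is_RInt_ext (fun _ => 1)).
  + intros x _; simpl; replace (2 * PI * 0 * x) with 0 by ring; rewrite cos_0; ring.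
  + evar_last; [apply (is_RInt_const (V := R_NormedModule))|].
    unfold scal; simpl; unfold mult; simpl; ring.
- assert (HP := PI_neq0).
  assert (Hj' : IZR j <> 0) by (intro E; apply Hj, eq_IZR, E).
  set (F := fun x => sin (2 * PI * IZR j * x) / (2 * PI * IZR j)).
  evar_last.
  + apply (is_RInt_derive (V := R_CompleteNormedModule) F).
    * intros x _; unfold F; auto_derive; [trivial|simpl; field; auto].
    * intros x _; apply (@ex_derive_continuous R_AbsRing R_NormedModule).
      auto_derive; trivial.
  + change (F 1 - F 0 = 0); unfold F; rewrite Rmult_0_r, sin_0, sin_eq_0_1.
    * field; auto.
    * exists (2 * j)%Z; rewrite mult_IZR; ring.
Qed.

(** The right-hand side is (i t)^k times a moment: cosine and sine of [INR k * (PI / 2)] are the two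
    parts of i^k, and each application of [A] is one use of [moment_convolution]. *)
Lemma op_pow_delta (A : (Z -> C) -> (Z -> C)) (t : R) (k : nat) (m n : Z) :
  0 < t -> is_convolution A parabola_weight t ->
  op_pow A k (delta m) n =
  (cos (INR k * (PI / 2)) * (t ^ k * moment k (n - m)),
   sin (INR k * (PI / 2)) * (t ^ k * moment k (n - m))).
Proof.
intros Ht HA; revert n; induction k as [|k IH]; intros n.
- simpl (op_pow _ _ _); rewrite moment_0; unfold delta; simpl INR.
  rewrite Rmult_0_l, cos_0, sin_0; simpl pow.
  destruct (Z.eq_dec n m), (Z.eq_dec (n - m) 0); try lia;
   apply injective_projections; simpl; ring.
(* [is_convolution] describes [A] on bounded sequences only; the bound is read off the induction
   hypothesis, moments being at most 1 in modulus. *)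
- assert (HB : bounded_by (t ^ k) (op_pow A k (delta m))).
  { intros l; rewrite IH; apply Cmod_le_of_sqr; [apply pow_le; lra|].
    rewrite Cmod_sqr; simpl (Re (_, _)); simpl (Im (_, _)).
    assert (B := moment_bound k (l - m)); apply Rabs_le_between in B.
    assert (E := sin2_cos2 (INR k * (PI / 2))); unfold Rsqr in E.
    replace (_ + _) with ((t ^ k) ^ 2 * moment k (l - m) ^ 2 *
      (sin (INR k * (PI / 2)) * sin (INR k * (PI / 2)) +
       cos (INR k * (PI / 2)) * cos (INR k * (PI / 2)))) by ring.
    rewrite E, Rmult_1_r.
    assert (M1 : moment k (l - m) ^ 2 <= 1) by nra.
    assert (T0 : 0 <= (t ^ k) ^ 2) by apply pow2_ge_0.
    apply (Rmult_le_compat_l _ _ _ T0) in M1; lra. }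
  change (op_pow A (S k) (delta m) n) with (A (op_pow A k (delta m)) n).
  rewrite (HA _ _ HB n).
  assert (ES : forall c, sumZ (fun l => parabola_weight l * (c * (t ^ k * moment k (n + l - m))))
     = c * (t ^ k * moment (S k) (n - m))).
  { intros c; rewrite <- moment_convolution, <- !sumZ_scal; apply sumZ_ext; intros l.
    replace (n + l - m)%Z with (n - m + l)%Z by ring; ring. }
  replace (CsumZ _) with ((cos (INR k * (PI / 2)) * (t ^ k * moment (S k) (n - m)),
     sin (INR k * (PI / 2)) * (t ^ k * moment (S k) (n - m))) : C).
  + replace (INR (S k) * (PI / 2)) with (INR k * (PI / 2) + PI / 2) by (rewrite S_INR; ring).
    rewrite cos_plus, sin_plus, cos_PI2, sin_PI2.
    apply injective_projections; simpl; ring.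
  + symmetry; apply injective_projections.
    * change (Re (CsumZ (fun k0 => parabola_weight k0 * op_pow A k (delta m) (n + k0)%Z)%C)
        = cos (INR k * (PI / 2)) * (t ^ k * moment (S k) (n - m))).
      rewrite Re_CsumZ, <- ES; apply sumZ_ext; intros l; now rewrite IH.
    * change (Im (CsumZ (fun k0 => parabola_weight k0 * op_pow A k (delta m) (n + k0)%Z)%C)
        = sin (INR k * (PI / 2)) * (t ^ k * moment (S k) (n - m))).
      rewrite Im_CsumZ, <- ES; apply sumZ_ext; intros l; now rewrite IH.
Qed.

Lemma exp_sum_delta (A : (Z -> C) -> (Z -> C)) (t : R) (m n : Z) :
  0 < t -> is_convolution A parabola_weight t ->
  exp_sum A (delta m) n =
  (oscillatory t 0 (n - m), oscillatory t (- (PI / 2)) (n - m)).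
Proof.
intros Ht HA; apply injective_projections; apply is_series_unique.
- refine (is_series_ext _ _ _ _ (is_series_oscillatory t 0 (n - m) Ht)); intros k.
  rewrite (Re_div_R _ _ (INR_fact_neq_0 k)), (op_pow_delta A t k m n Ht HA).
  now rewrite Rplus_0_l.
- refine (is_series_ext _ _ _ _ (is_series_oscillatory t (- (PI / 2)) (n - m) Ht)); intros k.
  rewrite (Im_div_R _ _ (INR_fact_neq_0 k)), (op_pow_delta A t k m n Ht HA).
  replace (- (PI / 2) + INR k * (PI / 2)) with (- (PI / 2 - INR k * (PI / 2))) by ring.
  now rewrite cos_neg, cos_shift.
Qed.

(** * Dispersive estimate *)

Lemma bounded_by_lin (M K : R) (f g : Z -> C) (c : C) : bounded_by M f -> bounded_by K g ->
  bounded_by (M + Cmod c * K) (fun n => f n + c * g n)%C.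
Proof.
intros Hf Hg n; eapply Rle_trans; [apply Cmod_triangle|]; rewrite Cmod_mult.
apply Rplus_le_compat; [apply Hf|apply Rmult_le_compat_l; [apply Cmod_ge_0|apply Hg]].
Qed.

Lemma CsumZ_lin (w : Z -> R) (f g : Z -> C) (c : C) (M K : R) : summableZ w ->
  bounded_by M f -> bounded_by K g ->
  CsumZ (fun k => w k * (f k + c * g k))%C =
  (CsumZ (fun k => w k * f k) + c * CsumZ (fun k => w k * g k))%C.
Proof.
intros Hw Hf Hg.
assert (F1 : summableZ (fun k => w k * Re (f k))) by (apply summableZ_mult_bounded with M;
  [exact Hw|]; intros k; eapply Rle_trans; [apply Rabs_Re_le|apply Hf]).
assert (F2 : summableZ (fun k => w k * Im (f k))) by (apply summableZ_mult_bounded with M;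
  [exact Hw|]; intros k; eapply Rle_trans; [apply Rabs_Im_le|apply Hf]).
assert (G1 : summableZ (fun k => w k * Re (g k))) by (apply summableZ_mult_bounded with K;
  [exact Hw|]; intros k; eapply Rle_trans; [apply Rabs_Re_le|apply Hg]).
assert (G2 : summableZ (fun k => w k * Im (g k))) by (apply summableZ_mult_bounded with K;
  [exact Hw|]; intros k; eapply Rle_trans; [apply Rabs_Im_le|apply Hg]).
apply injective_projections.
- change (Re (CsumZ (fun k => w k * (f k + c * g k))%C) =
    Re (CsumZ (fun k => w k * f k)%C) + (Re c * Re (CsumZ (fun k => w k * g k)%C)
     - Im c * Im (CsumZ (fun k => w k * g k)%C))).
  rewrite !Re_CsumZ, Im_CsumZ.
  rewrite (sumZ_ext (fun k => w k * Re (f k + c * g k)%C)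
    (fun k => w k * Re (f k) + (Re c * (w k * Re (g k)) + - Im c * (w k * Im (g k)))))
    by (intros; unfold Re, Im; simpl; ring).
  rewrite !sumZ_plus, !sumZ_scal by auto using summableZ_plus, summableZ_scal; ring.
- change (Im (CsumZ (fun k => w k * (f k + c * g k))%C) =
    Im (CsumZ (fun k => w k * f k)%C) + (Re c * Im (CsumZ (fun k => w k * g k)%C)
     + Im c * Re (CsumZ (fun k => w k * g k)%C))).
  rewrite !Im_CsumZ, Re_CsumZ.
  rewrite (sumZ_ext (fun k => w k * Im (f k + c * g k)%C)
    (fun k => w k * Im (f k) + (Re c * (w k * Im (g k)) + Im c * (w k * Re (g k)))))
    by (intros; unfold Re, Im; simpl; ring).
  rewrite !sumZ_plus, !sumZ_scal by auto using summableZ_plus, summableZ_scal; ring.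
Qed.

Lemma Cmod_le_Re_Im (z : C) : Cmod z <= Rabs (Re z) + Rabs (Im z).
Proof.
assert (H1 := Rabs_pos (Re z)); assert (H2 := Rabs_pos (Im z)).
apply Cmod_le_of_sqr; [lra|]; rewrite Cmod_sqr, <- (pow2_abs (Re z)), <- (pow2_abs (Im z)); nra.
Qed.

(** The half-open range makes [truncation 0] vanish and [truncation (S N)] live exactly on the
    integers of [windowZ] at [N]. *)
Definition truncation (N : nat) (psi : Z -> C) (n : Z) : C :=
  if ((- Z.of_nat N <=? n) && (n <? Z.of_nat N))%Z%bool then psi n else 0%C.

Lemma truncation_S (N : nat) (psi : Z -> C) (n : Z) :
  truncation (S N) psi n =
  (truncation N psi n + psi (Z.of_nat N) * delta (Z.of_nat N) n
   + psi (- Z.of_nat (S N))%Z * delta (- Z.of_nat (S N)) n)%C.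
Proof.
unfold truncation, delta.
destruct (Z.leb_spec (- Z.of_nat N) n), (Z.ltb_spec n (Z.of_nat N)),
  (Z.leb_spec (- Z.of_nat (S N)) n), (Z.ltb_spec n (Z.of_nat (S N))),
  (Z.eq_dec n (Z.of_nat N)), (Z.eq_dec n (- Z.of_nat (S N))); subst; simpl; try lia; ring.
Qed.

Lemma truncation_bounded (N : nat) (psi : Z -> C) (M : R) :
  bounded_by M psi -> bounded_by M (truncation N psi).
Proof.
intros H n; unfold truncation; destruct (_ && _)%bool; [apply H|].
rewrite Cmod_0; eapply Rle_trans; [apply Cmod_ge_0|apply (H n)].
Qed.

Lemma in_l1_bounded (psi : Z -> C) : in_l1 psi -> bounded_by (norm1 psi) psi.
Proof.
intros H n; apply (le_sumZ (fun k => Cmod (psi k)) n H); intros; apply Cmod_ge_0.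
Qed.

Lemma in_l1_in_l2 (psi : Z -> C) : in_l1 psi -> in_l2 psi.
Proof.
intros H; apply summableZ_le with (fun n => norm1 psi * Cmod (psi n)).
- intros n; rewrite Rabs_pos_eq by apply pow2_ge_0; simpl; rewrite Rmult_1_r.
  apply Rmult_le_compat_r; [apply Cmod_ge_0|now apply in_l1_bounded].
- now apply summableZ_scal.
Qed.

(** The error is measured in sup norm, where it is small because the terms of a summable family tend
    to zero; [exp_sum_bounded] accepts that norm. *)
Lemma truncation_tail (psi : Z -> C) (eps : R) : in_l1 psi -> 0 < eps ->
  exists N, bounded_by eps (fun n => psi n - truncation (S N) psi n)%C.
Proof.
intros [H1 H2] Heps.
assert (L1 := ex_series_lim_0 _ H1); assert (L2 := ex_series_lim_0 _ H2).
destruct (proj2 (is_lim_seq_spec _ _) L1 (mkposreal eps Heps)) as [N1 HN1].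
destruct (proj2 (is_lim_seq_spec _ _) L2 (mkposreal eps Heps)) as [N2 HN2].
exists (N1 + N2)%nat; intros n; unfold truncation.
destruct (Z.leb_spec (- Z.of_nat (S (N1 + N2))) n) as [A1|A1];
  [destruct (Z.ltb_spec n (Z.of_nat (S (N1 + N2)))) as [A2|A2]|]; cbv [andb].
- unfold Cminus; rewrite Cplus_opp_r, Cmod_0; lra.
- specialize (HN1 (Z.to_nat n) ltac:(lia)); simpl in HN1.
  rewrite Rminus_0_r, !Rabs_pos_eq, Z2Nat.id in HN1
    by (lia || apply Cmod_ge_0 || apply Rabs_pos).
  unfold Cminus; rewrite Copp_0, Cplus_0_r; lra.
- specialize (HN2 (Z.to_nat (- n - 1)) ltac:(lia)); cbv beta in HN2; simpl pos in HN2.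
  replace (- Z.of_nat (S (Z.to_nat (- n - 1))))%Z with n in HN2 by lia.
  rewrite Rminus_0_r, !Rabs_pos_eq in HN2 by (apply Cmod_ge_0 || apply Rabs_pos).
  unfold Cminus; rewrite Copp_0, Cplus_0_r; lra.
Qed.

Section Dispersion.

Variables (A : (Z -> C) -> (Z -> C)) (w : Z -> R) (t W : R).
Hypothesis HA : is_convolution A w t.
Hypothesis w_ge0 : forall k, 0 <= w k.
Hypothesis w_summable : summableZ w.
Hypothesis w_sum : sumZ w <= W.
Hypothesis W_gt0 : 0 < W.
Hypothesis t_gt0 : 0 < t.

Lemma op_pow_lin (f g : Z -> C) (c : C) (M K : R) (k : nat) (n : Z) :
  bounded_by M f -> bounded_by K g ->
  op_pow A k (fun n => f n + c * g n)%C n = (op_pow A k f n + c * op_pow A k g n)%C.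
Proof using All.
intros Hf Hg; revert n; induction k as [|k IH]; intros n; [reflexivity|].
assert (Bf := op_pow_bounded A w t W HA w_ge0 w_summable w_sum W_gt0 t_gt0 M f k Hf).
assert (Bg := op_pow_bounded A w t W HA w_ge0 w_summable w_sum W_gt0 t_gt0 K g k Hg).
change (A (op_pow A k (fun n => f n + c * g n)%C) n =
  (A (op_pow A k f) n + c * A (op_pow A k g) n)%C).
replace (op_pow A k (fun n => f n + c * g n)%C) with
  (fun n => op_pow A k f n + c * op_pow A k g n)%C
  by (apply functional_extensionality; intros l; symmetry; apply IH).
rewrite (HA _ _ (bounded_by_lin _ _ _ _ c Bf Bg) n), (HA _ _ Bf n), (HA _ _ Bg n).
rewrite (CsumZ_lin w (fun l => op_pow A k f (n + l)%Z) (fun l => op_pow A k g (n + l)%Z)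
  c _ _ w_summable (fun l => Bf (n + l)%Z) (fun l => Bg (n + l)%Z)).
ring.
Qed.

Lemma exp_sum_lin (f g : Z -> C) (c : C) (M K : R) (n : Z) :
  bounded_by M f -> bounded_by K g ->
  exp_sum A (fun n => f n + c * g n)%C n = (exp_sum A f n + c * exp_sum A g n)%C.
Proof using All.
intros Hf Hg.
destruct (ex_series_exp_sum A w t W HA w_ge0 w_summable w_sum W_gt0 t_gt0 M f n Hf) as [F1 F2].
destruct (ex_series_exp_sum A w t W HA w_ge0 w_summable w_sum W_gt0 t_gt0 K g n Hg) as [G1 G2].
apply Series_correct in F1; apply Series_correct in F2;
apply Series_correct in G1; apply Series_correct in G2.
assert (HR : forall (a b d : nat -> R) (la lb ld x y : R), is_series a la -> is_series b lb ->
  is_series d ld -> is_series (fun k => a k + (x * b k + y * d k)) (la + (x * lb + y * ld))).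
{ intros a b d la lb ld x y Ha Hb Hd.
  apply (is_series_plus (V := R_NormedModule) a (fun k => x * b k + y * d k) la); [exact Ha|].
  apply (is_series_plus (V := R_NormedModule) (fun k => x * b k) (fun k => y * d k));
   apply (is_series_scal (V := R_NormedModule)); assumption. }
apply injective_projections; apply is_series_unique.
- replace (fst _) with (fst (exp_sum A f n) + (Re c * fst (exp_sum A g n)
    + - Im c * snd (exp_sum A g n))) by (unfold Re, Im; simpl; ring).
  refine (is_series_ext _ _ _ _ (HR _ _ _ _ _ _ (Re c) (- Im c) F1 G1 G2)).
  intros k; rewrite (op_pow_lin f g c M K k n Hf Hg).
  assert (Hk := INR_fact_neq_0 k); unfold Re, Im; simpl; field; exact Hk.
- replace (snd _) with (snd (exp_sum A f n) + (Re c * snd (exp_sum A g n)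
    + Im c * fst (exp_sum A g n))) by (unfold Re, Im; simpl; ring).
  refine (is_series_ext _ _ _ _ (HR _ _ _ _ _ _ (Re c) (Im c) F2 G2 G1)).
  intros k; rewrite (op_pow_lin f g c M K k n Hf Hg).
  assert (Hk := INR_fact_neq_0 k); unfold Re, Im; simpl; field; exact Hk.
Qed.

(** Only continuity in sup norm is at stake: the growth in [t] and the factor 2 from adding real and
    imaginary parts disappear in the limit of truncations. *)
Lemma exp_sum_bounded (psi : Z -> C) (M : R) (n : Z) : bounded_by M psi ->
  Cmod (exp_sum A psi n) <= 2 * exp (t * W) * M.
Proof using All.
intros HM.
assert (HB := is_series_scal (V := R_NormedModule) M _ _ (is_series_exp_coeff t W)).
assert (HE : ex_series (fun k => M * exp_coeff t W k)) by (eexists; exact HB).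
assert (HBE : Series (fun k => M * exp_coeff t W k) = M * exp (t * W))
  by exact (is_series_unique _ _ HB).
assert (HT := Cmod_exp_term A w t W HA w_ge0 w_summable w_sum W_gt0 t_gt0 M psi).
assert (HS : forall a : nat -> R, (forall k, Rabs (a k) <= M * exp_coeff t W k) ->
  Rabs (Series a) <= M * exp (t * W)).
{ intros a Ha; rewrite <- HBE.
  eapply Rle_trans; [apply Series_Rabs|apply Series_le; [|exact HE]].
  - refine (@ex_series_le R_AbsRing R_CompleteNormedModule _ _ _ HE).
    intros k; change (norm ?y) with (Rabs y); rewrite Rabs_Rabsolu; apply Ha.
  - intros k; split; [apply Rabs_pos|apply Ha]. }
eapply Rle_trans; [apply Cmod_le_Re_Im|].
replace (2 * exp (t * W) * M) with (M * exp (t * W) + M * exp (t * W)) by ring.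
apply Rplus_le_compat; apply HS; intros k; eapply Rle_trans;
 [apply Rabs_Re_le|now apply HT|apply Rabs_Im_le|now apply HT].
Qed.

(** The values on point masses form the kernel of the operator. Its bound [K] passes to truncations
    by linearity, two point masses at a time, and to [psi] by continuity in sup norm. *)
Lemma exp_sum_dispersion (K : R) (psi : Z -> C) (n : Z) :
  (forall m, Cmod (exp_sum A (delta m) n) <= K) -> in_l1 psi ->
  Cmod (exp_sum A psi n) <= K * norm1 psi.
Proof using All.
intros HK Hpsi; assert (HB := in_l1_bounded psi Hpsi).
assert (HK0 : 0 <= K) by (eapply Rle_trans; [apply Cmod_ge_0|apply (HK 0%Z)]).
assert (Hstep : forall N, Cmod (exp_sum A (truncation (S N) psi) n) <=
  Cmod (exp_sum A (truncation N psi) n) +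
  K * (Cmod (psi (Z.of_nat N)) + Cmod (psi (- Z.of_nat (S N))%Z))).
{ intros N; assert (HT := truncation_bounded N psi _ HB).
  replace (truncation (S N) psi) with (fun l => truncation N psi l
    + psi (Z.of_nat N) * delta (Z.of_nat N) l
    + psi (- Z.of_nat (S N))%Z * delta (- Z.of_nat (S N)) l)%C
    by (apply functional_extensionality; intros l; symmetry; apply truncation_S).
  assert (HD := bounded_by_lin _ _ _ _ (psi (Z.of_nat N)) HT (delta_bounded (Z.of_nat N))).
  rewrite (exp_sum_lin _ _ _ _ _ _ HD (delta_bounded (- Z.of_nat (S N)))).
  rewrite (exp_sum_lin _ _ _ _ _ _ HT (delta_bounded (Z.of_nat N))).
  eapply Rle_trans; [apply Cmod_triangle|].
  eapply Rle_trans; [apply Rplus_le_compat_r, Cmod_triangle|].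
  rewrite !Cmod_mult, Rmult_plus_distr_l, Rplus_assoc.
  apply Rplus_le_compat_l, Rplus_le_compat; rewrite Rmult_comm;
   apply Rmult_le_compat_r; auto using Cmod_ge_0. }
assert (Hwin : forall N, Cmod (exp_sum A (truncation (S N) psi) n) <=
  K * windowZ (fun l => Cmod (psi l)) N).
{ induction N as [|N IH].
  - eapply Rle_trans; [apply Hstep|].
    (* The empty truncation is bounded by 0, so the sup bound makes its image zero. *)
    assert (H0 : Cmod (exp_sum A (truncation 0 psi) n) <= 2 * exp (t * W) * 0).
    { apply exp_sum_bounded; intros l; unfold truncation.
      destruct (Z.leb_spec (- Z.of_nat 0) l), (Z.ltb_spec l (Z.of_nat 0));
       simpl; rewrite ?Cmod_0; lra || lia. }
    rewrite windowZ_0; simpl in *; lra.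
  - eapply Rle_trans; [apply Hstep|]; rewrite windowZ_S; lra. }
apply le_epsilon; intros eps Heps.
assert (He := exp_pos (t * W)).
destruct (truncation_tail psi (eps / (2 * exp (t * W))) Hpsi) as [N HN];
 [apply Rdiv_lt_0_compat; lra|].
replace psi with (fun l => truncation (S N) psi l + 1 * (psi l - truncation (S N) psi l))%C at 1
  by (apply functional_extensionality; intros l; ring).
rewrite (exp_sum_lin _ _ _ _ _ _ (truncation_bounded (S N) psi _ HB) HN).
eapply Rle_trans; [apply Cmod_triangle|]; apply Rplus_le_compat.
- eapply Rle_trans; [apply Hwin|apply Rmult_le_compat_l; [exact HK0|]].
  apply windowZ_le_sumZ; [exact Hpsi|intros; apply Cmod_ge_0].
- rewrite Cmult_1_l; eapply Rle_trans; [apply exp_sum_bounded, HN|right; field; lra].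
Qed.

End Dispersion.

(** * The Schrödinger operator as a convolution, and its propagator *)

Lemma parabola_weight_eq (G : periodic_graph) :
  defined_by G (fun theta => (theta - 1 / 2) ^ 2) ->
  potential G = parabola_weight 0 /\
  forall k, k <> 0%Z -> weight G k = parabola_weight k.
Proof.
intros [H0 H]; split.
- apply RtoC_inj; rewrite <- H0; apply fourier_coeff_parabola0.
- intros k Hk; apply RtoC_inj; rewrite <- (H k Hk), (fourier_coeff_parabola Hk).
  unfold parabola_weight; now destruct (Z.eq_dec k 0).
Qed.

Lemma schrodinger_is_convolution (G : periodic_graph) (t : R) :
  defined_by G (fun theta => (theta - 1 / 2) ^ 2) ->
  is_convolution (fun psi n => Ci * t * schrodinger G psi n)%C parabola_weight t.
Proof.
intros HG M psi HM n; f_equal; destruct (parabola_weight_eq G HG) as [H0 H].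
unfold schrodinger; rewrite H0.
set (g := fun k => psi (n + k)%Z).
assert (HB : bounded_by M g) by (intros k; apply HM).
assert (SR : summableZ (fun k => parabola_weight k * Re (g k))).
{ apply summableZ_mult_bounded with M; [apply summableZ_parabola_weight|].
  intros k; eapply Rle_trans; [apply Rabs_Re_le|apply HB]. }
assert (SI : summableZ (fun k => parabola_weight k * Im (g k))).
{ apply summableZ_mult_bounded with M; [apply summableZ_parabola_weight|].
  intros k; eapply Rle_trans; [apply Rabs_Im_le|apply HB]. }
(* The potential supplies the term at 0 that the sum in [schrodinger] leaves out. *)
assert (HP : forall f : Z -> R, summableZ f ->
  sumZ (fun k => if Z.eq_dec k 0 then 0 else f k) + f 0%Z = sumZ f).
{ intros f Hf.
  destruct (sumZ_point (fun k => if Z.eq_dec k 0 then f k else 0)) as [P1 P2].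
  { intros k Hk; now destruct (Z.eq_dec k 0). }
  simpl in P2; rewrite <- P2, <- sumZ_plus; [|  |exact P1].
  - apply sumZ_ext; intros k; destruct (Z.eq_dec k 0); ring.
  - apply summableZ_le with (fun k => Rabs (f k)); [|now apply summableZ_abs].
    intros k; destruct (Z.eq_dec k 0); [rewrite Rabs_R0; apply Rabs_pos|lra]. }
apply injective_projections.
- change (sumZ (fun k => Re (if Z.eq_dec k 0 then RtoC 0 else weight G k * psi (n + k)%Z)%C)
    + Re (parabola_weight 0 * psi n)%C =
    Re (CsumZ (fun k => parabola_weight k * g k)%C)).
  rewrite Re_CsumZ, <- (HP _ SR); f_equal.
  + apply sumZ_ext; intros k; destruct (Z.eq_dec k 0) as [|Hk]; [reflexivity|].
    rewrite (H k Hk); unfold g, Re; simpl; ring.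
  + unfold g; rewrite Z.add_0_r; unfold Re; simpl; ring.
- change (sumZ (fun k => Im (if Z.eq_dec k 0 then RtoC 0 else weight G k * psi (n + k)%Z)%C)
    + Im (parabola_weight 0 * psi n)%C =
    Im (CsumZ (fun k => parabola_weight k * g k)%C)).
  rewrite Im_CsumZ, <- (HP _ SI); f_equal.
  + apply sumZ_ext; intros k; destruct (Z.eq_dec k 0) as [|Hk]; [reflexivity|].
    rewrite (H k Hk); unfold g, Im; simpl; ring.
  + unfold g; rewrite Z.add_0_r; unfold Im; simpl; ring.
Qed.

Lemma sumZ_parabola_weight_gt0 : 0 < sumZ parabola_weight.
Proof.
apply Rlt_le_trans with (parabola_weight 0); [unfold parabola_weight; simpl; lra|].
apply le_sumZ; [apply summableZ_parabola_weight|apply parabola_weight_ge0].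
Qed.

Lemma propagator_delta (G : periodic_graph) (t : R) (m n : Z) :
  defined_by G (fun theta => (theta - 1 / 2) ^ 2) -> 0 < t ->
  propagator G t (delta m) n =
  (oscillatory t 0 (n - m), oscillatory t (- (PI / 2)) (n - m)).
Proof.
intros HG Ht; assert (HA := schrodinger_is_convolution G t HG).
unfold propagator; erewrite op_exp_eq; eauto using parabola_weight_ge0,
  summableZ_parabola_weight, sumZ_parabola_weight_gt0, Rle_refl.
- now apply exp_sum_delta.
- apply in_l1_in_l2, (sumZ_delta m (fun x => x)); reflexivity.
Qed.

Lemma propagator_bound (G : periodic_graph) (t : R) (psi : Z -> C) (n : Z) :
  defined_by G (fun theta => (theta - 1 / 2) ^ 2) -> 0 < t -> in_l1 psi ->
  Cmod (propagator G t psi n) <= 8 * / sqrt t * norm1 psi.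
Proof.
intros HG Ht Hpsi; assert (HA := schrodinger_is_convolution G t HG).
unfold propagator; erewrite op_exp_eq; eauto using parabola_weight_ge0,
  summableZ_parabola_weight, sumZ_parabola_weight_gt0, Rle_refl, in_l1_in_l2.
eapply exp_sum_dispersion; eauto using parabola_weight_ge0,
  summableZ_parabola_weight, sumZ_parabola_weight_gt0, Rle_refl.
intros m; rewrite (exp_sum_delta _ t m n Ht HA).
eapply Rle_trans; [apply Cmod_le_Re_Im|].
replace (8 * / sqrt t) with (4 * / sqrt t + 4 * / sqrt t) by ring.
apply Rplus_le_compat; now apply oscillatory_bound.
Qed.

(** * Operator norms and sharpness of the exponent *)

Lemma norm_l1_linfty_le (B : (Z -> C) -> (Z -> C)) (K : R) : 0 <= K ->
  (forall psi n, in_l1 psi -> Cmod (B psi n) <= K * norm1 psi) ->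
  Rbar_le (norm_l1_linfty B) K.
Proof.
intros HK H; unfold norm_l1_linfty, Rbar_lub; apply (proj2_sig (Rbar_ex_lub _)).
intros x (psi & H1 & H2 & ->); apply Lub_Rbar_correct.
intros y (n & ->); simpl; eapply Rle_trans; [now apply H|].
rewrite <- (Rmult_1_r K) at 2; now apply Rmult_le_compat_l.
Qed.

Lemma le_norm_l1_linfty (B : (Z -> C) -> (Z -> C)) (m n : Z) :
  Rbar_le (Cmod (B (delta m) n)) (norm_l1_linfty B).
Proof.
apply Rbar_le_trans with (norm_infty (B (delta m))).
- apply Lub_Rbar_correct; now exists n.
- unfold norm_l1_linfty, Rbar_lub; apply (proj2_sig (Rbar_ex_lub _)).
  destruct (sumZ_delta m (fun x => x) eq_refl) as [H1 H2].
  exists (delta m); split; [exact H1|split; [|reflexivity]].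
  unfold norm1; rewrite H2; lra.
Qed.

Lemma Rpower_neg_half (t : R) : 0 < t -> Rpower t (- (1 / 2)) = / sqrt t.
Proof.
intros Ht; rewrite Rpower_Ropp; f_equal.
replace (1 / 2) with (/ 2) by field; now apply Rpower_sqrt.
Qed.

Theorem proposition7p10
  (G : periodic_graph)
  (HG : defined_by G (fun theta : R => (theta - 1 / 2) ^ 2)) :
  (forall t : R, 0 < t ->
     Rbar_le (norm_l1_linfty (propagator G t))
             (Finite (8 * Rpower t (- (1 / 2))))) /\
  ~ (exists beta C : R, 1 / 2 < beta /\ 0 < C /\
       forall t : R, 1 <= t ->
         Rbar_le (norm_l1_linfty (propagator G t))
                 (Finite (C * Rpower t (- beta)))).
Proof.
split.
- intros t Ht; rewrite (Rpower_neg_half t Ht); apply norm_l1_linfty_le.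
  + apply Rmult_le_pos; [lra|]; apply Rlt_le, Rinv_0_lt_compat, sqrt_lt_R0, Ht.
  + intros psi n Hpsi; now apply propagator_bound.
- intros (beta & C & Hbeta & HC & H).
  set (g := beta - 1 / 2); assert (Hg : 0 < g) by (unfold g; lra).
  (* At time [exp s] the lower bound on the diagonal entry and the assumed decay would force
     [exp (g * s) <= 4 * C]. But [g * s = 6 * g + 4 * C] makes the exponential larger, and the 6
     puts the time above the threshold 25/4 of [oscillatory_lower]. *)
  set (s := 6 + 4 * C / g).
  assert (Hs : 6 <= s) by (assert (0 < 4 * C / g) by (apply Rdiv_lt_0_compat; lra);
    unfold s; lra).
  assert (Ht : 7 <= exp s) by (assert (E := exp_ineq1_le s); lra).
  assert (Hgs : 4 * C < exp (g * s)).
  { apply Rlt_le_trans with (1 + g * s); [|apply exp_ineq1_le].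
    replace (g * s) with (6 * g + 4 * C) by (unfold s; field; lra); lra. }
  assert (Hle := Rbar_le_trans _ _ _ (le_norm_l1_linfty (propagator G (exp s)) 0 0)
    (H (exp s) ltac:(lra))).
  rewrite propagator_delta in Hle by (auto; lra); simpl in Hle.
  assert (L1 := oscillatory_lower (exp s) ltac:(lra)).
  assert (L2 := Rabs_Re_le (oscillatory (exp s) 0 0, oscillatory (exp s) (- (PI / 2)) 0)).
  assert (L3 := Rle_abs (oscillatory (exp s) 0 0)); simpl in L2.
  rewrite <- Rpower_neg_half in L1 by lra.
  assert (E : exp (g * s) * Rpower (exp s) (- beta) = Rpower (exp s) (- (1 / 2))).
  { unfold Rpower; rewrite ln_exp, <- exp_plus; f_equal; unfold g; field. }
  assert (HP : 0 < Rpower (exp s) (- beta)) by apply exp_pos.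
  assert (HF : 4 * C * Rpower (exp s) (- beta) < Rpower (exp s) (- (1 / 2)))
    by (rewrite <- E; now apply Rmult_lt_compat_r).
  lra.
Qed.
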